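(* Let $(M,*,\mathfrak g,\mathbf J)$ be a Hamiltonian quantum $\mathfrak g$-space over a Poisson manifold $M$. For all $\kappa\in[0,1]$: (i) $\Theta_\kappa=\Omega+\mathbf J+i\lambda(1-2\kappa)\chi$, where $\chi\in\mathfrak g^*\subset\mathcal A^{1,0}[[\lambda]]$ is the trace form $\chi(\xi)=\frac12\operatorname{tr}(\operatorname{ad}(\xi))$, $\xi\in\mathfrak g$. (ii) $\Theta_\kappa\star_\kappa\Theta_\kappa=0$. (iii) The classical ghost number derivation $\mathsf{Gh}=\{\gamma,\cdot\}$ equals $\frac{1}{i\lambda}\operatorname{ad}_\kappa(\gamma)$ for all $\kappa\in[0,1]$, and it induces the ghost number grading: for all $\Phi\in\mathcal A[[\lambda]]$ and $m\in\mathbb Z$, $\mathsf{Gh}(\Phi)=m\Phi$ if and only if $\Phi\in\mathcal A^{(m)}[[\lambda]]$. (iv) $[\mathsf{Gh},\mathcal D_\kappa]=\mathcal D_\kappa$; hence $\mathcal D_\kappa$ raises the ghost number by one.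
   Context: Setting. $(M,\Lambda)$ is a Poisson manifold; $C^\infty(M)$ denotes complex-valued smooth functions with Poisson bracket $\{\cdot,\cdot\}$. A star product $*$ is a $\mathbb C[[\lambda]]$-bilinear associative product $f*g=\sum_{r\ge0}\lambda^rC_r(f,g)$ on $C^\infty(M)[[\lambda]]$ with bidifferential operators $C_r$, $C_0(f,g)=fg$, $C_1(f,g)-C_1(g,f)=i\{f,g\}$, and $C_r$ ($r\ge1$) vanishing on constants. $\mathfrak g$ is a real Lie algebra of finite dimension $n$ with basis $e_1,\dots,e_n$, dual basis $e^1,\dots,e^n$ of $\mathfrak g^*$ and $[e_a,e_b]=\sum_c f^c{}_{ab}e_c$. A Hamiltonian quantum $\mathfrak g$-space $(M,*,\mathfrak g,\mathbf J)$ is a Poisson manifold with star product $*$ and a formal series $\mathbf J=J+O(\lambda)$ of smooth maps $M\to\mathfrak g^*$ such that $J$ is a classical momentum map ($\{\langle J,\xi\rangle,\langle J,\eta\rangle\}=\langle J,[\xi,\eta]\rangle$) and $\langle\mathbf J,\xi\rangle*\langle\mathbf J,\eta\rangle-\langle\mathbf J,\eta\rangle*\langle\mathbf J,\xi\rangle=i\lambda\langle\mathbf J,[\xi,\eta]\rangle$ for all $\xi,\eta\in\mathfrak g$. Write $\mathbf J_a=\langle\mathbf J,e_a\rangle$. BRST algebra. $\mathcal A^{k,l}=\bigwedge^k\mathfrak g^*\otimes\bigwedge^l\mathfrak g\otimes C^\infty(M)$, $\mathcal A=\bigoplus\mathcal A^{k,l}$, $\mathcal A^{(m)}=\bigoplus_{k-l=m}\mathcal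 A^{k,l}$ (ghost number $m$). We identify $\bigwedge\mathfrak g^*\otimes\bigwedge\mathfrak g$ with $\bigwedge(\mathfrak g^*\oplus\mathfrak g)$ (graded $\wedge$-product); parity is the total Grassmann degree mod 2. Left insertions: for $\alpha\in\bigwedge^k\mathfrak g^*$, $\xi\in\bigwedge\mathfrak g$, $X\in\mathfrak g$, $\beta\in\mathfrak g^*$: $i(X)(\alpha\otimes\xi)=(i(X)\alpha)\otimes\xi$, $i(\beta)(\alpha\otimes\xi)=(-1)^k\alpha\otimes i(\beta)\xi$. Right insertion: $j(v)a=-(-1)^mi(v)a$ for $a\in\bigwedge^m(\mathfrak g^*\oplus\mathfrak g)$. On (ungraded) tensor products set $P=\sum_aj(e_a)\otimes i(e^a)$, $P^*=\sum_aj(e^a)\otimes i(e_a)$, and let $\mu$ be the $\wedge$-multiplication. The super Poisson bracket on $\mathcal A$ is $\{a\otimes F,b\otimes G\}=a\wedge b\otimes\{F,G\}+\{a,b\}\otimes FG$ with $\{a,b\}=2\mu\circ(P+P^* )(a\otimes b)$. For $\kappa\in[0,1]$ let $a\circ_\kappa b=\mu\circ e^{2i\lambda(\kappa P+(1-\kappa)P^* )}(a\otimes b)$ and $(a\otimes F)\star_\kappa(b\otimes G)=(a\circ_\kappa b)\otimes(F*G)$ on $\mathcal A[[\lambda]]$. $\operatorname{ad}_\kappa$ is the super-commutator with respect to $\star_\kappa$. Set $\Delta=\sum_ai(e_a)i(e^a)$ and $S_t=\exp(2it\lambda\Delta)$ for $t\in\mathbb R$. Charges and operators. $\Omega=-\frac14\sum_{a,b,c}f^c{}_{ab}\,e^a\wedge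 e^b\wedge e_c$; $\mathbf J$ is regarded as $\sum_ae^a\otimes\mathbf J_a\in\mathcal A^{1,0}[[\lambda]]$; $\gamma=\frac12\sum_ae^a\wedge e_a$. The Weyl ordered charge is $\Theta_{\mathrm W}=\Omega+\mathbf J$, and $\mathcal D_{\mathrm W}=\frac1{i\lambda}\operatorname{ad}_{1/2}(\Theta_{\mathrm W})$. For $\kappa\in[0,1]$: $\Theta_\kappa=S_{\kappa-1/2}^{-1}(\Theta_{\mathrm W})$ and $\mathcal D_\kappa=S_{\kappa-1/2}^{-1}\circ\mathcal D_{\mathrm W}\circ S_{\kappa-1/2}=\frac1{i\lambda}\operatorname{ad}_\kappa(\Theta_\kappa)$. *)

(* Defs.v *)
From HB Require Import structures.
From mathcomp Require Import all_boot all_order all_algebra complex.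
From mathcomp Require Import boolp classical_sets functions reals.
From mathcomp Require Import topology normedtype derive.
From mathcomp Require Import ring.
Set Implicit Arguments.
Unset Strict Implicit.
Unset Printing Implicit Defensive.
Import Order.TTheory GRing.Theory Num.Theory.
Import numFieldNormedType.Exports.
Local Open Scope classical_set_scope.
Local Open Scope ring_scope.

Section Euclidean.
Context {R : realType} {d : nat}.
Implicit Types (U : set 'rV[R]_d) (f g : 'rV[R]_d -> R).

Definition pderiv (i : 'I_d) f : 'rV[R]_d -> R := 'D_(delta_mx 0 i) f.

(* Meaningful for open U: f is of class C^k on U; values outside U are
   irrelevant. *)
Fixpoint Ck (k : nat) U f : Prop :=
  (forall x, U x -> {for x, continuous f}) /\
  (if k is k'.+1 then
     forall i, (forall x, U x -> derivable f x (delta_mx 0 i)) /\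
               Ck k' U (pderiv i f)
   else True).

Definition smooth_on U f : Prop := forall k, Ck k U f.

Lemma near_open U f g x : open U -> U x ->
  (forall y, U y -> f y = g y) -> \forall y \near x, f y = g y.
Proof. by move=> oU Ux fg; near=> y; apply: fg; near: y; exact: open_nbhs_nbhs.
Unshelve. all: by end_near. Qed.

Lemma continuous_eq_on U f g x : open U -> U x ->
  (forall y, U y -> f y = g y) -> {for x, continuous f} -> {for x, continuous g}.
Proof.
move=> oU Ux fg cf; rewrite /prop_for /continuous_at -(fg x Ux).
exact: (cvg_trans (near_eq_cvg (near_open oU Ux fg)) cf).
Qed.

Lemma Ck_eq k U f g : open U -> (forall y, U y -> f y = g y) ->
  Ck k U f -> Ck k U g.
Proof.
move=> oU; elim: k f g => [|k IH] f g fg /= [cf df].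
  by split=> // x Ux; apply: (continuous_eq_on oU Ux fg); exact: cf.
split=> [x Ux|i]; first by apply: (continuous_eq_on oU Ux fg); exact: cf.
have [dfi Cfi] := df i; split=> [x Ux|].
  apply: (near_eq_derivable _ (dfi _ Ux)).
  exact: (near_open oU Ux fg).
apply: IH Cfi => y Uy; rewrite /pderiv; apply: near_eq_derive.
exact: (near_open oU Uy fg).
Qed.

Lemma CkS k U f : Ck k.+1 U f -> Ck k U f.
Proof.
elim: k f => [|k IH] f [cf df]; split=> // i.
by have [dfi Cfi] := df i; split=> //; exact: IH.
Qed.

Lemma Ck_cst k U (a : R) : Ck k U (cst a).
Proof.
elim: k a => [|k IH] a; (split; first by move=> x _; exact: cst_continuous) => //.
move=> i; split=> [x _|]; first exact: derivable_cst.
by have -> : pderiv i (cst a) = cst 0;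
  [apply/funext=> x; exact: derive_cst | exact: IH].
Qed.

Lemma CkD k U f g : open U -> Ck k U f -> Ck k U g -> Ck k U (f + g).
Proof.
move=> oU; elim: k f g => [|k IH] f g [cf df] [cg dg];
  (split; first by move=> x Ux;
    exact: (@continuousD _ _ _ f g x (cf _ Ux) (cg _ Ux))) => //.
move=> i; have [dfi Cfi] := df i; have [dgi Cgi] := dg i.
split=> [x Ux|]; first by apply: derivableD; [exact: dfi|exact: dgi].
apply: Ck_eq (IH _ _ Cfi Cgi) => // y Uy.
by rewrite /pderiv deriveD //; [exact: dfi|exact: dgi].
Qed.

Lemma CkM k U f g : open U -> Ck k U f -> Ck k U g -> Ck k U (f * g).
Proof.
move=> oU; elim: k f g => [|k IH] f g Cf Cg;
  (split; first by move=> x Ux;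
    exact: (@continuousM _ _ f g x (Cf.1 _ Ux) (Cg.1 _ Ux))) => //.
move=> i; have [dfi Cfi] := Cf.2 i; have [dgi Cgi] := Cg.2 i.
split=> [x Ux|]; first by apply: derivableM; [exact: dfi|exact: dgi].
apply: Ck_eq (CkD oU (IH _ _ (CkS Cf) Cgi) (IH _ _ (CkS Cg) Cfi)) => // y Uy.
by rewrite /pderiv deriveM //; [exact: dfi|exact: dgi].
Qed.

Lemma smooth_on_cst U (a : R) : smooth_on U (cst a).
Proof. by move=> k; exact: Ck_cst. Qed.

Lemma smooth_onD U f g : open U ->
  smooth_on U f -> smooth_on U g -> smooth_on U (f + g).
Proof. by move=> oU sf sg k; exact: CkD. Qed.

Lemma smooth_onM U f g : open U ->
  smooth_on U f -> smooth_on U g -> smooth_on U (f * g).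
Proof. by move=> oU sf sg k; exact: CkM. Qed.

Lemma eq_smooth_on U f g : f =1 g -> smooth_on U f -> smooth_on U g.
Proof. by move=> /funext ->. Qed.

End Euclidean.

(* chart_fun and chart_inv are total functions, relevant only on chart_dom and
   chart_cod respectively. *)
Record chart (R : realType) (T : topologicalType) (d : nat) := Chart {
  chart_dom : set T;
  chart_cod : set 'rV[R]_d;
  chart_fun :> T -> 'rV[R]_d;
  chart_inv : 'rV[R]_d -> T }.

Definition chart_homeo (R : realType) (T : topologicalType) (d : nat)
    (c : chart R T d) : Prop :=
  [/\ open (chart_dom c) /\ open (chart_cod c),
      (forall x, chart_dom c x -> chart_cod c (c x) /\ chart_inv c (c x) = x),
      (forall y, chart_cod c y ->
         chart_dom c (chart_inv c y) /\ c (chart_inv c y) = y),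
      (forall x, chart_dom c x -> {for x, continuous c}) &
      (forall y, chart_cod c y -> {for y, continuous (chart_inv c)})].

Record manifold (R : realType) := Manifold {
  carrier :> topologicalType;
  mdim : nat;
  atlas : set (chart R carrier mdim);
  manifold_hausdorff : hausdorff_space carrier;
  manifold_second_countable : @second_countable carrier;
  atlas_homeo : forall c, atlas c -> chart_homeo c;
  atlas_cover : forall x, exists2 c, atlas c & chart_dom c x;
  atlas_smooth : forall c c', atlas c -> atlas c' -> forall i,
    smooth_on (chart_cod c `&` chart_inv c @^-1` chart_dom c')
              (fun y => c' (chart_inv c y) 0 i) }.

Section SmoothFunctions.
Context {R : realType} {M : manifold R}.
Local Notation C := (R[i]^o).
Implicit Types (c : chart R M (mdim M)) (f : M -> C).

Definition smooth_in_chart c f : Prop :=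
  smooth_on (chart_cod c) (fun y => complex.Re (f (chart_inv c y))) /\
  smooth_on (chart_cod c) (fun y => complex.Im (f (chart_inv c y))).

Definition smooth f : Prop := forall c, atlas c -> smooth_in_chart c f.

Definition smoothb : {pred M -> C} := fun f => `[< smooth f >].

Lemma smooth_cst (a : C) : smooth (cst a).
Proof. by move=> c _; split; exact: smooth_on_cst. Qed.

Lemma smoothD f g : smooth f -> smooth g -> smooth (f + g).
Proof.
move=> sf sg c Ac; have [[_ oc] _ _ _ _] := atlas_homeo Ac.
have [rf jf] := sf _ Ac; have [rg jg] := sg _ Ac.
split; [apply: eq_smooth_on (smooth_onD oc rf rg)
       |apply: eq_smooth_on (smooth_onD oc jf jg)] => y;
  by rewrite !fctE; case: (f _) => ? ?; case: (g _).
Qed.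

Lemma smoothM f g : smooth f -> smooth g -> smooth (f * g).
Proof.
move=> sf sg c Ac; have [[_ oc] _ _ _ _] := atlas_homeo Ac.
have [rf jf] := sf _ Ac; have [rg jg] := sg _ Ac.
have mN h : smooth_on (chart_cod c) h ->
    smooth_on (chart_cod c) (cst (-1) * h).
  by move=> sh; apply: smooth_onM => //; exact: smooth_on_cst.
split;
  [apply: eq_smooth_on (smooth_onD oc (smooth_onM oc rf rg)
                                      (mN _ (smooth_onM oc jf jg)))
  |apply: eq_smooth_on (smooth_onD oc (smooth_onM oc rf jg)
                                      (smooth_onM oc jf rg))] => y;
  rewrite !fctE; case: (f _) => ? ?; case: (g _) => ? ? //=.
by rewrite mulN1r.
Qed.

Lemma smooth_subring : subring_closed smoothb.
Proof.
split; first by apply/asboolP; exact: smooth_cst.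
- move=> f g /asboolP sf /asboolP sg; apply/asboolP.
  have -> : f - g = f + cst (-1) * g.
    by apply/funext=> x; rewrite !fctE mulN1r.
  by apply: smoothD => //; apply: smoothM => //; exact: smooth_cst.
- by move=> f g /asboolP sf /asboolP sg; apply/asboolP; exact: smoothM.
Qed.

Lemma smooth_submod : submod_closed smoothb.
Proof.
split; first by apply/asboolP; exact: smooth_cst.
move=> a f g /asboolP sf /asboolP sg; apply/asboolP.
by apply: smoothD => //; apply: (@smoothM (cst a)) => //; exact: smooth_cst.
Qed.

HB.instance Definition _ :=
  GRing.isSubringClosed.Build (M -> C) smoothb smooth_subring.
HB.instance Definition _ :=
  GRing.isSubmodClosed.Build _ (M -> C) smoothb smooth_submod.

End SmoothFunctions.

Record Cinf (R : realType) (M : manifold R) := MkCinf {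
  cinf_fun :> M -> R[i]^o;
  cinf_smoothb : cinf_fun \in smoothb }.

HB.instance Definition _ (R : realType) (M : manifold R) :=
  [isSub of Cinf M for @cinf_fun R M].
HB.instance Definition _ (R : realType) (M : manifold R) :=
  [Choice of Cinf M by <:].
HB.instance Definition _ (R : realType) (M : manifold R) :=
  [SubChoice_isSubZmodule of Cinf M by <:].
HB.instance Definition _ (R : realType) (M : manifold R) :=
  GRing.SubZmodule_isSubPzRing.Build (M -> R[i]^o) smoothb (Cinf M)
    smooth_subring.
HB.instance Definition _ (R : realType) (M : manifold R) :=
  GRing.SubPzRing_isSubComPzRing.Build (M -> R[i]^o) smoothb (Cinf M).
HB.instance Definition _ (R : realType) (M : manifold R) :=
  [SubZmodule_isSubLmodule of Cinf M by <:].

Section Poisson.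
Context {R : realType} {M : manifold R}.
Implicit Types f g h : Cinf M.

Definition real_valued f : Prop := forall x, complex.Im (f x) = 0.

(* Poisson structures are given by their bracket, extended C-bilinearly to
   complex-valued functions. *)
Definition poisson_bracket (pb : Cinf M -> Cinf M -> Cinf M) : Prop :=
  [/\ (forall (a : R[i]) f g h, pb (a *: f + g) h = a *: pb f h + pb g h),
      (forall f g, pb f g = - pb g f),
      (forall f g h, pb f (g * h) = pb f g * h + g * pb f h),
      (forall f g h, pb f (pb g h) + pb g (pb h f) + pb h (pb f g) = 0) &
      (forall f g, real_valued f -> real_valued g -> real_valued (pb f g))].

(* The value at x of the iterated partial derivative of f along the list of
   indices s, in the coordinates of the chart c. *)
Definition chart_pderivs (c : chart R M (mdim M)) (s : seq 'I_(mdim M))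
    (f : M -> R[i]^o) (x : M) : R[i] :=
  (foldr pderiv (fun y => complex.Re (f (chart_inv c y))) s (c x) +i*
   foldr pderiv (fun y => complex.Im (f (chart_inv c y))) s (c x))%C.

Definition bidifferential (B : Cinf M -> Cinf M -> Cinf M) : Prop :=
  exists k : nat, forall c, atlas c ->
  exists (q : nat) (s t : 'I_q -> seq 'I_(mdim M)) (u : 'I_q -> M -> R[i]^o),
    (forall j, [/\ (size (s j) <= k)%N, (size (t j) <= k)%N &
                   smooth_in_chart c (u j)]) /\
    (forall f g x, chart_dom c x ->
       B f g x =
       \sum_j u j x * chart_pderivs c (s j) f x * chart_pderivs c (t j) g x).

Implicit Types F G H : nat -> Cinf M.

(* A formal power series in lambda is its sequence of coefficients. *)
Definition star_series (C : nat -> Cinf M -> Cinf M -> Cinf M) F G :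
    nat -> Cinf M :=
  fun r => \sum_(s < r.+1) \sum_(p < (r - s).+1) C s (F p) (G (r - s - p)%N).

Definition star_product (pb : Cinf M -> Cinf M -> Cinf M)
    (C : nat -> Cinf M -> Cinf M -> Cinf M) : Prop :=
  [/\ (forall r, bidifferential (C r)) /\
      (forall r (a : R[i]) f g h,
         C r (a *: f + g) h = a *: C r f h + C r g h /\
         C r h (a *: f + g) = a *: C r h f + C r h g),
      (forall F G H, star_series C (star_series C F G) H =
                     star_series C F (star_series C G H)),
      (forall f g, C 0%N f g = f * g),
      (forall f g, C 1%N f g - C 1%N g f = 'i%C *: pb f g) &
      (forall r f (a : R[i]), C r.+1 f (a *: (1 : Cinf M)) = 0 /\
                     C r.+1 (a *: (1 : Cinf M)) f = 0)].

End Poisson.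

Section FormalSeries.
Context {R : realType} {V : lmodType R[i]}.

Definition lambda0 (v : V) : nat -> V := fun r => if r is 0%N then v else 0.

Definition mul_ilambda (u : nat -> V) : nat -> V :=
  fun r => if r is r'.+1 then 'i%C *: u r' else 0.

(* Meaningful on series without constant term, where it inverts
   [mul_ilambda]. *)
Definition div_ilambda (u : nat -> V) : nat -> V := fun r => - 'i%C *: u r.+1.

Lemma div_ilambdaK u : u 0%N = 0 -> mul_ilambda (div_ilambda u) = u.
Proof.
move=> u0; apply/funext; case=> [|r] //=.
by rewrite /div_ilambda scalerA mulrN -expr2 sqr_i opprK scale1r.
Qed.

Lemma mul_ilambdaK u : div_ilambda (mul_ilambda u) = u.
Proof.
apply/funext=> r.
by rewrite /div_ilambda /= scalerA mulNr -expr2 sqr_i opprK scale1r.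
Qed.

End FormalSeries.

Definition lie_bracket (R : realType) (g : vectType R) (br : g -> g -> g) :
    Prop :=
  [/\ (forall (a : R) x y z, br (a *: x + y) z = a *: br x z + br y z),
      (forall (a : R) x y z, br z (a *: x + y) = a *: br z x + br z y),
      (forall x, br x x = 0) &
      (forall x y z, br x (br y z) + br y (br z x) + br z (br x y) = 0)].

Section MomentumMap.
Context {R : realType} {M : manifold R} {g : vectType R}.

(* Smooth maps from M to the (real) dual of g. *)
Record smooth_dual := SmoothDual {
  sd_fun :> M -> 'Hom(g, R^o);
  sd_smooth : forall xi : g, smooth (fun x => (sd_fun x xi)%:C%C : R[i]^o) }.

Definition pairing (J : smooth_dual) (xi : g) : Cinf M :=
  MkCinf (introT (asboolP _) (sd_smooth J xi)).

Definition quantum_momentum_map (pb : Cinf M -> Cinf M -> Cinf M)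
    (C : nat -> Cinf M -> Cinf M -> Cinf M) (br : g -> g -> g)
    (J : nat -> smooth_dual) : Prop :=
  (forall xi eta, pb (pairing (J 0%N) xi) (pairing (J 0%N) eta) =
                  pairing (J 0%N) (br xi eta)) /\
  (forall xi eta, star_series C (pairing^~ xi \o J) (pairing^~ eta \o J) -
                  star_series C (pairing^~ eta \o J) (pairing^~ xi \o J) =
                  mul_ilambda (pairing^~ (br xi eta) \o J)).

End MomentumMap.
Arguments smooth_dual {R} M g.

Lemma sum_triangle (W : nmodType) (F : nat -> nat -> W) r :
  \sum_(p < r.+1) \sum_(q < (r - p).+1) F p q =
  \sum_(m < r.+1) \sum_(p < m.+1) F p (m - p)%N.
Proof.
elim: r => [|r IH]; first by rewrite !big_ord1.
rewrite [RHS]big_ord_recr /= -IH.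
rewrite [X in _ = _ + X]big_ord_recr /= addrA.
rewrite [LHS]big_ord_recr /= subnn big_ord1; congr (_ + _).
rewrite -big_split /=; apply: eq_bigr => p _.
have pr : (p <= r)%N by rewrite -ltnS.
by rewrite (subSn pr) big_ord_recr.
Qed.

Lemma exp_coefD (F : numFieldType) (x y : F) m :
  \sum_(p < m.+1) (x ^+ p / p`!%:R) * (y ^+ (m - p) / (m - p)`!%:R) =
  (x + y) ^+ m / m`!%:R.
Proof.
rewrite addrC exprDn mulr_suml; apply: eq_bigr => p _.
have pm : (p <= m)%N by rewrite -ltnS.
have f0 k : k`!%:R != 0 :> F by rewrite pnatr_eq0 -lt0n fact_gt0.
rewrite -mulr_natr -(bin_fact pm) !natrM.
have b0 : 'C(m, p)%:R != 0 :> F by rewrite pnatr_eq0 -lt0n bin_gt0.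
by field; rewrite b0 !f0.
Qed.

(* The Grassmann algebra of (dual of g) + g is coordinatised by the basis of
   monomials in the generators e^1, ..., e^n, e_1, ..., e_n, in this order:
   a subset I of 'I_(n + n) stands for the increasing product of its elements,
   [lshift n a] being e^a and [rshift n a] being e_a.  *)
Section Grassmann.
Context {R : realType} {n : nat}.
Local Notation K := (R[i]^o).
Local Notation gen := ('I_(n + n)).

Definition grass (V : Type) := {ffun {set gen} -> V}.

Definition up (a : 'I_n) : gen := lshift n a.
Definition low (a : 'I_n) : gen := rshift n a.

Definition inversions (I J : {set gen}) : nat :=
  #|[set p : gen * gen | [&& p.1 \in I, p.2 \in J & (p.2 < p.1)%N]]%SET|.

Definition monomial (I : {set gen}) : grass K := [ffun L => (L == I)%:R].
Definition generator (v : gen) : grass K := monomial [set v]%SET.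

Definition wedge (a b : grass K) : grass K :=
  [ffun L : {set gen} => \sum_(I : {set gen} | I \subset L)
     (-1) ^+ inversions I (L :\: I) * a I * b (L :\: I)].

Lemma wedge_monomial (A B : {set gen}) :
  wedge (monomial A) (monomial B) =
  [ffun L : {set gen} => if (A \subset L) && (L :\: A == B)
                         then (-1) ^+ inversions A B else 0].
Proof.
apply/ffunP=> L; rewrite !ffunE.
have z (I : {set gen}) : I != A ->
    (-1) ^+ inversions I (L :\: I) * monomial A I * monomial B (L :\: I) = 0.
  by move=> /negPf IA; rewrite /monomial !ffunE IA mulr0 mul0r.
case: ifP => [/andP[AL /eqP LA]|AB].
  rewrite (bigD1 A) //= big1 => [|I /andP[_ IA]]; last exact: z.
  by rewrite LA !ffunE !eqxx !mulr1 addr0.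
rewrite big1 // => I IL; case: (eqVneq I A) => [IA|/z //].
by move: AB; rewrite -IA IL /= /monomial !ffunE => ->; rewrite mulr0.
Qed.

Lemma wedge_monomialC (A B : {set gen}) :
  wedge (monomial B) (monomial A) =
  (-1 : R[i]) ^+ (odd #|A| && odd #|B|) *: wedge (monomial A) (monomial B).
Proof.
rewrite !wedge_monomial; apply/ffunP=> L; rewrite !ffunE.
have sw (X Y : {set gen}) : (X \subset L) && (L :\: X == Y) ->
    (Y \subset L) && (L :\: Y == X).
  move=> /andP[XL /eqP <-]; rewrite subsetDl /=.
  apply/eqP/finset.setP=> x; rewrite !inE.
  by have := fintype.subsetP XL x; case: (x \in X); case: (x \in L) => // /(_ isT).
case: ifP => [BA|BA]; case: ifP => [AB|AB]; last by rewrite scaler0.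
- have dAB x : x \in A -> x \notin B.
    by move/andP: AB => [_ /eqP <-] xA; rewrite !inE xA.
  have card : (inversions A B + inversions B A)%N = (#|A| * #|B|)%N.
    rewrite -finset.cardsX /inversions.
    pose sw2 (p : gen * gen) := (p.2, p.1).
    rewrite -[X in (_ + X)%N](card_imset _ (_ : injective sw2)); last first.
      by case=> ? ? [? ?] [-> ->].
    rewrite -cardsUI [X in (_ + X)%N](_ : _ = 0%N) ?addn0; last first.
      apply/eqP; rewrite cards_eq0; apply/eqP/finset.setP=> -[x y]; rewrite !inE.
      apply/negP=> /andP[/and3P[_ _ yx] /imsetP[[y' x']]].
      by rewrite inE /= => /and3P[_ _ xy] [ex ey]; subst; move: yx xy => /= /ltnW; rewrite leqNgt => /negPf ->.
    congr #|pred_of_set _|; apply/finset.setP=> -[x y]; rewrite !inE /=.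
    apply/orP/andP=> [[/and3P[-> ->] //|/imsetP[[y' x']]]|[xA yB]].
      by rewrite inE /= => /and3P[? ? _] [-> ->].
    case: (ltngtP y x) => [yx|xy|xy]; first by left; rewrite xA yB.
    - by right; apply/imsetP; exists (y, x); rewrite // inE /= xA yB.
    - have xy' : x = y by apply: val_inj.
      by have := dAB _ xA; rewrite xy' yB.
  have -> : (-1) ^+ inversions B A =
      (-1) ^+ (#|A| * #|B|) * (-1) ^+ inversions A B :> R[i].
    by rewrite -card exprD mulrC mulrA -exprD -[(-1) ^+ (_ + _)]signr_odd addnn odd_double mul1r.
  by rewrite -signr_odd oddM.
- by rewrite sw in AB.
- by rewrite sw in BA.
Qed.

Section Insertions.
Context {V : lmodType R[i]}.

(* Contraction from the left with the element dual to the generator v. *)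
Definition insl (v : gen) (a : grass V) : grass V :=
  [ffun L : {set gen} => if v \in L then 0
             else (-1 : R[i]) ^+ inversions [set v]%SET L *: a (v |: L)].

Definition insr (v : gen) (a : grass V) : grass V :=
  insl v [ffun L : {set gen} => - ((-1 : R[i]) ^+ #|L| *: a L)].

(* i(e_a), i(e^a), j(e_a), j(e^a).  The sign (-1)^k of i(e^a) on a form of
   degree k comes from the order of the generators. *)
Definition ivec (a : 'I_n) := insl (up a).
Definition icov (a : 'I_n) := insl (low a).
Definition jvec (a : 'I_n) := insr (up a).
Definition jcov (a : 'I_n) := insr (low a).

Definition Delta (a : grass V) : grass V := \sum_k ivec k (icov k a).

Definition ghost (I : {set gen}) : int :=
  #|[set a | up a \in I]%SET|%:Z - #|[set a | low a \in I]%SET|%:Z.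

(* The part of parity p. *)
Definition parity_part (p : bool) (u : nat -> grass V) : nat -> grass V :=
  fun r => [ffun I : {set gen} => if odd #|I| == p then u r I else 0].

(* Homogeneity of ghost number m. *)
Definition ghost_homog (m : int) (u : nat -> grass V) : Prop :=
  forall r I, ghost I != m -> u r I = 0.

(* exp (2 i t lambda Delta), acting on formal series. *)
Definition Sop (t : R) (u : nat -> grass V) : nat -> grass V :=
  fun r => \sum_(s < r.+1)
    ((2 * 'i%C * t%:C%C) ^+ s / s`!%:R) *: iter s Delta (u (r - s)%N).

Lemma Delta_linear : linear Delta.
Proof.
have il v : linear (insl v).
  move=> a x y; apply/ffunP=> L; rewrite !ffunE.
  case: ifP => _; first by rewrite scaler0 addr0.
  by rewrite scalerDr !scalerA mulrC.
move=> a x y; rewrite /Delta scaler_sumr -big_split /=.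
by apply: eq_bigr => k _; rewrite /ivec /icov !il.
Qed.
HB.instance Definition _ := GRing.isLinear.Build R[i] _ _ _ Delta Delta_linear.

Lemma iter_Delta_linear p : linear (iter p Delta).
Proof. by elim: p => [|p IH] a x y //=; rewrite IH linearP. Qed.
HB.instance Definition _ p := GRing.isLinear.Build R[i] _ _ _ (iter p Delta)
  (iter_Delta_linear p).

Lemma SopD s t u : Sop s (Sop t u) = Sop (s + t) u.
Proof.
apply/funext=> r.
pose c (x : R) p : R[i] := (2 * 'i%C * x%:C%C) ^+ p / p`!%:R.
pose F p q := (c s p * c t q) *: iter (p + q) Delta (u (r - (p + q))%N).
transitivity (\sum_(p < r.+1) \sum_(q < (r - p).+1) F p q).
  apply: eq_bigr => p _; rewrite linear_sum scaler_sumr.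
  by apply: eq_bigr => q _; rewrite linearZ /= scalerA -iterD -subnDA.
rewrite sum_triangle; apply: eq_bigr => m _.
rewrite rmorphD /= mulrDr -exp_coefD scaler_suml; apply: eq_bigr => p _.
have pm : (p <= m)%N by rewrite -ltnS.
by rewrite /F (subnKC pm).
Qed.

Lemma Sop0 u : Sop 0 u = u.
Proof.
apply/funext=> r; rewrite /Sop big_ord_recl /= expr0 subn0 fact0 divr1 scale1r.
by rewrite big1 ?addr0 // => i _; rewrite mulr0 expr0n mul0r scale0r.
Qed.

Lemma SopK t : cancel (Sop t) (Sop (- t)).
Proof. by move=> u; rewrite SopD addNr Sop0. Qed.

Lemma SopNK t : cancel (Sop (- t)) (Sop t).
Proof. by move=> u; rewrite SopD subrr Sop0. Qed.

End Insertions.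

(* The ungraded tensor square of the Grassmann algebra: the coordinate at
   (I, J) is the coefficient of monomial I tensor monomial J. *)
Definition grass2 := {ffun {set gen} * {set gen} -> K}.

Definition tensor (a b : grass K) : grass2 := [ffun p => a p.1 * b p.2].

Definition tensor_op (f h : grass K -> grass K) (x : grass2) : grass2 :=
  \sum_p x p *: tensor (f (monomial p.1)) (h (monomial p.2)).

Definition mu (x : grass2) : grass K :=
  \sum_p x p *: wedge (monomial p.1) (monomial p.2).

Definition Pop (x : grass2) : grass2 := \sum_a tensor_op (jvec a) (icov a) x.
Definition Pstar (x : grass2) : grass2 := \sum_a tensor_op (jcov a) (ivec a) x.

Definition grass_bracket (a b : grass K) : grass K :=
  2 *: mu (Pop (tensor a b) + Pstar (tensor a b)).

(* The r-th coefficient in lambda of mu o exp (2 i lambda (kappa P + (1 - kappa)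
   Pstar)) applied to a tensor b. *)
Definition circ (kappa : R) (a b : grass K) : nat -> grass K :=
  fun r => ((2 * 'i%C) ^+ r / r`!%:R) *:
    mu (iter r (fun x => kappa%:C%C *: Pop x + (1 - kappa)%:C%C *: Pstar x)
               (tensor a b)).

End Grassmann.
Arguments grass {n} V.

(* An element of the Grassmann algebra tensored with C^oo(M) is the family of
   its coefficients on the monomials.  The operations below are given by their
   values on decomposable elements, extended bilinearly: an element u is the
   sum over I of otimes (monomial I) (u I). *)
Section BRST.
Context {R : realType} {M : manifold R} {n : nat}.
Context (pb : Cinf M -> Cinf M -> Cinf M)
        (C : nat -> Cinf M -> Cinf M -> Cinf M).
Local Notation K := (R[i]^o).

Local Notation gen := ('I_(n + n)).
Local Notation brst := (@grass n (Cinf M)).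

Definition otimes (a : grass K) (F : Cinf M) : brst := [ffun I => a I *: F].

Definition super_bracket (u v : nat -> brst) : nat -> brst :=
  fun r => \sum_(s < r.+1) \sum_I \sum_J
   (otimes (wedge (monomial I) (monomial J)) (pb (u s I) (v (r - s)%N J)) +
    otimes (grass_bracket (monomial I) (monomial J)) (u s I * v (r - s)%N J)).

Definition star (kappa : R) (u v : nat -> brst) : nat -> brst :=
  fun r => \sum_(s < r.+1) \sum_I \sum_J
    otimes (circ kappa (monomial I) (monomial J) s)
           (star_series C (fun k => u k I) (fun k => v k J) (r - s)%N).

(* The graded commutator: (-1)^(pq) occurs for parts of parities p and q. *)
Definition super_ad (kappa : R) (u v : nat -> brst) : nat -> brst :=
  star kappa u v -
  \sum_(p : bool) \sum_(q : bool)
    (-1 : R[i]) ^+ (p && q) *: star kappa (parity_part q v) (parity_part p u).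

Lemma super_ad0 kappa u v : (forall f h, C 0%N f h = f * h) ->
  super_ad kappa u v 0%N = 0.
Proof.
move=> C0.
have star0 (x y : nat -> brst) : star kappa x y 0%N = \sum_I \sum_J
    otimes (wedge (monomial I) (monomial J)) (x 0%N I * y 0%N J).
  rewrite /star big_ord1; apply: eq_bigr => I _; apply: eq_bigr => J _.
  rewrite /star_series !big_ord1 C0; congr (otimes _ _).
  rewrite /circ expr0 fact0 divr1 scale1r /mu /=.
  rewrite (bigD1 (I, J)) //= big1 => [|[p q] pq].
    by rewrite !ffunE /= !eqxx mulr1 scale1r addr0.
  by rewrite !ffunE /= -natrM mulnb -xpair_eqE (negPf pq) scale0r.
have dscale (a : R[i]) (F : {set gen} -> {set gen} -> brst) :
    a *: (\sum_I \sum_J F I J) = \sum_I \sum_J a *: F I J.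
  by rewrite scaler_sumr; apply: eq_bigr => I _; rewrite scaler_sumr.
have dsplit (F G : {set gen} -> {set gen} -> brst) :
    \sum_I \sum_J F I J + \sum_I \sum_J G I J = \sum_I \sum_J (F I J + G I J).
  by rewrite -big_split; apply: eq_bigr => I _; rewrite -big_split.
have oZ (a : R[i]) (x : grass K) F : otimes (a *: x) F = a *: otimes x F.
  by apply/ffunP=> I; rewrite !ffunE scalerA.
have o0 (x : grass K) : otimes x 0 = 0.
  by apply/ffunP=> I; rewrite !ffunE scaler0.
rewrite /super_ad !big_bool.
transitivity (star kappa u v 0%N -
  ((-1 : R[i]) *: star kappa (parity_part true v) (parity_part true u) 0%N +
   (1 : R[i]) *: star kappa (parity_part false v) (parity_part true u) 0%N +
  ((1 : R[i]) *: star kappa (parity_part true v) (parity_part false u) 0%N +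
   (1 : R[i]) *: star kappa (parity_part false v) (parity_part false u) 0%N))).
  by [].
rewrite !star0 !dscale !dsplit exchange_big /=.
apply/eqP; rewrite subr_eq0; apply/eqP.
apply: eq_bigr => J _; apply: eq_bigr => I _.
rewrite !ffunE (wedge_monomialC I J) !oZ.
case: (odd #|I|); case: (odd #|J|) => /=;
  by rewrite ?mul0r ?mulr0 ?o0 ?scaler0 ?addr0 ?add0r !scalerA
             ?mulrNN ?mulN1r ?mul1r ?scale1r mulrC.
Qed.

Definition gamma : nat -> brst :=
  lambda0 (2^-1 *: \sum_a otimes (wedge (generator (up a)) (generator (low a))) 1).

Definition Gh : (nat -> brst) -> nat -> brst := super_bracket gamma.

Context {g : vectType R} (br : g -> g -> g) (e : n.-tuple g)
        (J : nat -> smooth_dual M g).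

(* [e_a, e_b] is the sum over c of structure_const c a b times e_c. *)
Definition structure_const (c a b : 'I_n) : R := coord e c (br e`_a e`_b).

Definition Omega : nat -> brst :=
  lambda0 (- 4^-1 *: \sum_a \sum_b \sum_c
    otimes ((structure_const c a b)%:C%C *:
            wedge (wedge (generator (up a)) (generator (up b)))
                  (generator (low c))) 1).

Definition Jcharge : nat -> brst :=
  fun r => \sum_a otimes (generator (up a)) (pairing (J r) e`_a).

(* The matrix of ad xi in the basis e, in row-vector convention. *)
Definition ad_mx (xi : g) : 'M[R]_n := \matrix_(a, b) coord e b (br xi e`_a).

Definition trace_form (xi : g) : R := 2^-1 * \tr (ad_mx xi).

Definition chi : nat -> brst :=
  lambda0 (\sum_(a < n) otimes ((trace_form e`_a)%:C%C *: generator (up a)) 1).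

Definition Theta_W : nat -> brst := Omega + Jcharge.

(* By [D_WE], super_ad has no constant term here, so that the division by
   i lambda is exact. *)
Definition D_W (u : nat -> brst) : nat -> brst :=
  div_ilambda (super_ad 2^-1 Theta_W u).

Lemma D_WE u : (forall f h, C 0%N f h = f * h) ->
  mul_ilambda (D_W u) = super_ad 2^-1 Theta_W u.
Proof. by move=> C0; apply: div_ilambdaK; exact: super_ad0. Qed.

(* Sop (- t) is the two-sided inverse of Sop t, by [SopK] and [SopNK]. *)
Definition Theta_kappa (kappa : R) : nat -> brst := Sop (- (kappa - 2^-1)) Theta_W.

Definition D_kappa (kappa : R) (u : nat -> brst) : nat -> brst :=
  Sop (- (kappa - 2^-1)) (D_W (Sop (kappa - 2^-1) u)).

End BRST.

(* Main.v *)
Require Import Defs.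
From HB Require Import structures.
From mathcomp Require Import all_boot all_order all_algebra complex.
From mathcomp Require Import boolp classical_sets functions reals.
From mathcomp Require Import topology normedtype derive.
From mathcomp Require Import ring.
Set Implicit Arguments.
Unset Strict Implicit.
Unset Printing Implicit Defensive.
Import Order.TTheory GRing.Theory Num.Theory.
Local Open Scope ring_scope.

(* No intertwining of the products for different kappa is needed.  The
   correction i lambda (1 - 2 kappa) chi only adds to J_a a scalar multiple of
   the unit, which is central, and chi vanishes on brackets; so Theta_kappa is
   Omega plus another quantum momentum map, and it suffices to square such a
   charge.  Since Omega is odd and contains e_c only once, Omega o_kappa Omega
   can only fail to vanish with one or two contractions: one contraction gives
   the Jacobi identity, two give a sum that changes sign when each generator is
   replaced by its dual.  The cross terms with J have one contraction and cancel
   J * J by the momentum map relation.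
   Similarly only the single contractions survive in the commutator with gamma,
   and they count ghosts.  Finally the star product is additive in the ghost
   number and Theta_W has ghost number 1, whence the statement on D_kappa. *)

(** * The Grassmann algebra *)

(** The obstacle is signs: ordered monomials, left and right insertions and two kinds of generators
    each bring their own. Once associativity and the relation [insl_wedge_gen] are established,
    elements are built from the unit by multiplication with generators ([gen_ind]), and parity is
    carried by the involution [grade], so that most sign rules hold without assuming homogeneous
    elements. P and P* are merged into one sum over all 2n generators v, each contracted against its
    dual and weighted by kappa or 1 - kappa. At one contraction kappa drops out of the relevant
    (anti)commutators because the weights of v and of its dual add up to 1; at two contractions only
    the product of these two weights matters, and it is symmetric. The factors i lambda are produced
    by single contractions: each carries 2i, to be combined with the 1/2 of gamma or the -1/4 of
    Omega. *)

Section Wedge.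
Context {R : realType} {n : nat}.
Local Notation K := (R[i]^o).
Local Notation gen := ('I_(n + n)).
Local Notation G := (@grass n K).
Implicit Types (a b c : G) (v w x : gen) (A B L : {set gen}).

(** As a double sum the inversion number is visibly additive over disjoint unions in each argument,
    which is what the signs in [wedgeA] require. *)
Lemma inversionsE A B : inversions A B =
  (\sum_(x in A) \sum_(y in B) (y < x)%N)%N.
Proof.
rewrite /inversions cardsE -sum1_card.
rewrite [RHS](eq_bigr (fun x => \sum_(y | (y \in B) && (y < x)%N) 1)%N); last first.
  by move=> x _; rewrite -big_mkcondr; apply: eq_bigr.
by rewrite pair_big_dep /=; apply: eq_bigl => -[x y].
Qed.

Lemma big_disjointU (W : nmodType) (F : gen -> W) A B : [disjoint A & B] ->
  \sum_(x in A :|: B) F x = \sum_(x in A) F x + \sum_(x in B) F x.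
Proof.
by move=> AB; rewrite -bigU //=; apply: eq_bigl => x; rewrite !inE.
Qed.

Lemma inversionsUl A B L : [disjoint A & B] ->
  inversions (A :|: B) L = (inversions A L + inversions B L)%N.
Proof. by move=> AB; rewrite !inversionsE; exact: big_disjointU. Qed.

Lemma inversionsUr A B L : [disjoint A & B] ->
  inversions L (A :|: B) = (inversions L A + inversions L B)%N.
Proof.
move=> AB; rewrite !inversionsE -big_split; apply: eq_bigr => x _.
exact: big_disjointU.
Qed.

Lemma grassE a : a = \sum_A a A *: monomial A.
Proof.
apply/ffunP => L; rewrite sum_ffunE (bigD1 L) //= big1 ?addr0.
  by rewrite !ffunE eqxx [RHS]mulr1.
by move=> A /negPf AL; rewrite !ffunE eq_sym AL [LHS]mulr0.
Qed.

Lemma wedge_linearl b : linear (@wedge R n ^~ b).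
Proof.
move=> k x y; apply/ffunP => L; rewrite !ffunE scaler_sumr -big_split.
apply: eq_bigr => A _; rewrite !ffunE /GRing.scale /=; ring.
Qed.

Lemma wedge_linearr a : linear (@wedge R n a).
Proof.
move=> k x y; apply/ffunP => L; rewrite !ffunE scaler_sumr -big_split.
apply: eq_bigr => A _; rewrite !ffunE /GRing.scale /=; ring.
Qed.

HB.instance Definition _ := bilinear_isBilinear.Build _ _ _ _ _ _ (@wedge R n)
  (conj wedge_linearl wedge_linearr).

(** The test in [wedge_monomial] singles out the only candidate [L], the union of [A] and [B], and
    can succeed only if they are disjoint. *)
Lemma wedge_monomialE A B :
  wedge (monomial A) (monomial B) =
  if [disjoint A & B] then (-1 : R[i]) ^+ inversions A B *: monomial (A :|: B)
  else 0 :> G.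
Proof.
rewrite wedge_monomial; apply/ffunP => L; rewrite ffunE.
case: ifP => [/andP[AL /eqP <-]|h].
  have -> : [disjoint A & L :\: A].
    by rewrite finset.disjoints_subset; apply/fintype.subsetP => x xA; rewrite !inE xA.
  have -> : A :|: (L :\: A) = L.
    apply/finset.setP => x; rewrite !inE.
    by have := fintype.subsetP AL x; case: (x \in A) => // ->.
  by rewrite !ffunE eqxx [RHS]mulr1.
case: ifP => AB; last by rewrite ffunE.
rewrite !ffunE; case: (L =P A :|: B) h => [->|_ _]; last by rewrite [RHS]mulr0.
rewrite finset.subsetUl /= => /eqP[]; apply/finset.setP => x; rewrite !inE.
by have := @disjointFl _ _ _ x AB; case: (x \in A); case: (x \in B) => // /(_ isT).
Qed.

(** Bilinearity is a hypothesis, packed into a structure inside the proof, so that the lemma also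
    applies to anonymous maps such as [fun a b => tensor (f a) (h b)]. *)
Lemma bilinear_grassE (V : lmodType R[i]) (B : G -> G -> V) a b :
  bilinear_for *:%R *:%R B ->
  B a b = \sum_I \sum_J (a I * b J) *: B (monomial I) (monomial J).
Proof.
move=> hB; pose b2 := bilinear_isBilinear.Build _ _ _ _ _ _ B hB.
pose B' : {bilinear G -> G -> V} := HB.pack B b2.
rewrite -[LHS]/(B' a b) {1}[a]grassE {1}[b]grassE linear_sumlz.
apply: eq_bigr => I _; rewrite linearZl_LR linear_sumr scaler_sumr.
by apply: eq_bigr => J _; rewrite linearZr_LR scalerA.
Qed.

Lemma bilinear_grass_pairE (V : lmodType R[i]) (B : G -> G -> V) a b :
  bilinear_for *:%R *:%R B ->
  B a b = \sum_(p : {set gen} * {set gen})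
    (a p.1 * b p.2) *: B (monomial p.1) (monomial p.2).
Proof. by move=> hB; rewrite (bilinear_grassE a b hB); exact: pair_bigA. Qed.

Lemma grass_ind (P : G -> Prop) :
  (forall k a b, P a -> P b -> P (k *: a + b)) -> (forall A, P (monomial A)) ->
  forall a, P a.
Proof.
move=> PD Pm a; have P0 : P 0.
  have := PD (-1) _ _ (Pm finset.set0) (Pm finset.set0).
  by rewrite scaleN1r addNr.
rewrite [a]grassE; elim/big_ind: _ => // [x y Px Py|A _].
  by rewrite -[x]scale1r; exact: PD.
by rewrite -[_ *: _]addr0; exact: PD.
Qed.

Lemma wedgePl k a b c : wedge (k *: a + b) c = k *: wedge a c + wedge b c.
Proof. exact: wedge_linearl. Qed.
Lemma wedgePr k a b c : wedge c (k *: a + b) = k *: wedge c a + wedge c b.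
Proof. exact: wedge_linearr. Qed.
Lemma wedge0l a : wedge 0 a = 0. Proof. exact: linear0l. Qed.
Lemma wedge0r a : wedge a 0 = 0. Proof. exact: linear0r. Qed.
Lemma wedgeZl k a b : wedge (k *: a) b = k *: wedge a b.
Proof. exact: linearZl_LR. Qed.
Lemma wedgeZr k a b : wedge a (k *: b) = k *: wedge a b.
Proof. exact: linearZr_LR. Qed.
Lemma wedgeNl a b : wedge (- a) b = - wedge a b.
Proof. exact: linearNl. Qed.
Lemma wedgeNr a b : wedge a (- b) = - wedge a b.
Proof. exact: linearNr. Qed.
Lemma wedge_suml I (r : seq I) (P : pred I) F b :
  wedge (\sum_(i <- r | P i) F i) b = \sum_(i <- r | P i) wedge (F i) b.
Proof. exact: linear_sumlz. Qed.
Lemma wedge_sumr I (r : seq I) (P : pred I) F b :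
  wedge b (\sum_(i <- r | P i) F i) = \sum_(i <- r | P i) wedge b (F i).
Proof. exact: linear_sumr. Qed.

(** On monomials both sides vanish unless the three sets are pairwise disjoint; otherwise both signs
    have the exponent inv(A, B) + inv(A, L) + inv(B, L). *)
Lemma wedgeA a b c : wedge a (wedge b c) = wedge (wedge a b) c.
Proof.
elim/grass_ind: a => [k a a' IH IH'|A]; first by rewrite !wedgePl IH IH'.
elim/grass_ind: b => [k b b' IH IH'|B].
  by rewrite wedgePl !wedgePr wedgePl IH IH'.
elim/grass_ind: c => [k c c' IH IH'|L]; first by rewrite !wedgePr IH IH'.
rewrite !wedge_monomialE.
have dU : [disjoint A :|: B & L] = [disjoint A & L] && [disjoint B & L].
  by rewrite -!finset.setI_eq0 finset.setIUl finset.setU_eq0.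
have dU' : [disjoint A & B :|: L] = [disjoint A & B] && [disjoint A & L].
  by rewrite -!finset.setI_eq0 finset.setIUr finset.setU_eq0.
case: (boolP [disjoint A & B]) => AB; case: (boolP [disjoint B & L]) => BL;
  rewrite ?wedge0l ?wedge0r ?wedgeZl ?wedgeZr ?wedge_monomialE
    ?dU ?dU' ?AB ?BL ?(negPf AB) ?(negPf BL) ?andbF /= ?scaler0 //.
rewrite andbT; case AL: [disjoint A & L]; last by rewrite [LHS]scaler0 [RHS]scaler0.
rewrite [LHS]scalerA [RHS]scalerA -!exprD finset.setUA.
rewrite (inversionsUl _ AB) (inversionsUr _ BL).
by rewrite addnC addnA.
Qed.

(** The parity automorphism. It turns right insertions into left ones ([insrE]) and expresses the
    sign of passing an odd generator across an arbitrary element. *)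
Definition grade a : G := [ffun A : {set gen} => (-1 : R[i]) ^+ #|A| *: a A].

Definition unit_grass : G := monomial finset.set0.

Lemma insl_linear (V : lmodType R[i]) v : linear (@insl R n V v).
Proof.
move=> k x y; apply/ffunP=> L; rewrite !ffunE.
case: ifP => _; first by rewrite scaler0 addr0.
by rewrite scalerDr !scalerA mulrC.
Qed.
HB.instance Definition _ V v := GRing.isLinear.Build R[i] _ _ _ (@insl R n V v)
  (insl_linear v).

Lemma grade_linear : linear grade.
Proof.
move=> k x y; apply/ffunP=> L; rewrite !ffunE.
by rewrite scalerDr !scalerA mulrC.
Qed.
HB.instance Definition _ := GRing.isLinear.Build R[i] _ _ _ grade grade_linear.

Lemma gradeK : involutive grade.
Proof.
move=> a; apply/ffunP => L; rewrite !ffunE scalerA -exprD addnn.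
by rewrite -signr_odd odd_double scale1r.
Qed.

Lemma insrE v a : insr v a = - insl v (grade a).
Proof.
rewrite /insr -linearN; congr insl; apply/ffunP => L; by rewrite !ffunE.
Qed.

Lemma insr_linear v : linear (@insr R n K v).
Proof. by move=> k x y; rewrite !insrE grade_linear insl_linear opprD scalerN. Qed.
HB.instance Definition _ v := GRing.isLinear.Build R[i] _ _ _ (@insr R n K v)
  (insr_linear v).

Lemma inversions1 v L : inversions [set v] L = (\sum_(x in L) (x < v)%N)%N.
Proof. by rewrite inversionsE big_set1. Qed.

Lemma wedge_genE v a L : wedge (generator v) a L =
  if v \in L then (-1 : R[i]) ^+ inversions [set v] (L :\ v) *: a (L :\ v) else 0.
Proof.
rewrite ffunE; case: ifP => vL.
  rewrite (bigD1 [set v]) ?finset.sub1set //= big1 ?addr0 => [|A /andP[_ /negPf Av]].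
    by rewrite ffunE eqxx mulr1.
  by rewrite ffunE Av mulr0 mul0r.
rewrite big1 // => A AL; rewrite ffunE; case: eqP AL => [->|_ _].
  by rewrite finset.sub1set vL.
by rewrite mulr0 mul0r.
Qed.

Lemma wedge_unitr a : wedge a unit_grass = a.
Proof.
elim/grass_ind: a => [k a b IH IH'|A]; first by rewrite wedgePl IH IH'.
rewrite wedge_monomialE disjoint_sym -finset.setI_eq0 finset.set0I eqxx.
rewrite finset.setU0 inversionsE big1 ?scale1r // => x _.
by rewrite big_set0.
Qed.

Lemma insl_unit v : insl v unit_grass = 0.
Proof.
apply/ffunP => L; rewrite !ffunE; case: ifP => // _.
have -> : (v |: L == finset.set0) = false.
  by apply/negbTE/finset.set0Pn; exists v; rewrite !inE eqxx.
exact: mulr0.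
Qed.

Lemma wedge_unitl a : wedge unit_grass a = a.
Proof.
elim/grass_ind: a => [k a b IH IH'|A]; first by rewrite wedgePr IH IH'.
rewrite wedge_monomialE -finset.setI_eq0 finset.set0I eqxx.
rewrite finset.set0U inversionsE big_set0; exact: scale1r.
Qed.

End Wedge.

Lemma eq_oppr_eq0 (F : numFieldType) (V : lmodType F) (x : V) : x = - x -> x = 0.
Proof.
move=> /eqP; rewrite -subr_eq0 opprK -mulr2n -scaler_nat scaler_eq0.
by rewrite pnatr_eq0 => /eqP.
Qed.

(** * Anticommutation relations of multiplications and insertions *)

Section Contraction.
Context {R : realType} {n : nat}.
Local Notation K := (R[i]^o).
Local Notation gen := ('I_(n + n)).
Local Notation G := (@grass n K).
Implicit Types (a b c : G) (v w x : gen) (A B L : {set gen}).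

Lemma inversions1U v w L : w \notin L ->
  inversions [set v] (w |: L) = ((w < v) + inversions [set v] L)%N.
Proof. by move=> wL; rewrite !inversions1 big_setU1. Qed.

(** The canonical anticommutation relation: multiplication by [w] creates, insertion of [v]
    annihilates. Together with [insl_unit] it determines [insl], so that later computations can
    avoid inversions. *)
Lemma insl_wedge_gen v w a :
  insl v (wedge (generator w) a) =
  (v == w)%:R *: a - wedge (generator w) (insl v a).
Proof.
apply/ffunP => L; rewrite [LHS]ffunE [RHS]ffunE wedge_genE.
rewrite [X in _ = X + _]ffunE [X in _ = _ + X]ffunE wedge_genE.
case: (eqVneq v w) => [<-|vw].
  rewrite [_ *: a L]mul1r.
  have [vL|vL] := boolP (v \in L).
    rewrite ffunE !inE eqxx /= finset.setD1K //.
    by rewrite [X in _ - X]scalerA -expr2 sqrr_sign scale1r subrr.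
  rewrite !inE eqxx /= oppr0 addr0 finset.setU1K //.
  by rewrite scalerA -expr2 sqrr_sign scale1r.
rewrite [_ *: a L]mul0r add0r ffunE !inE vw /= [w == v]eq_sym (negPf vw) /=.
have [vL|vL] := boolP (v \in L).
  by case: (w \in L); rewrite ?scaler0 oppr0.
have [wL|wL] := boolP (w \in L); last by rewrite scaler0 oppr0.
have -> : (v |: L) :\ w = v |: (L :\ w).
  apply/finset.setP => x; rewrite !inE.
  by case: (eqVneq x v) => [->|//] /=; rewrite vw.
rewrite !scalerA -scaleNr; congr (_ *: _).
(* The exponents on the two sides differ by (w < v) + (v < w), which is 1 because [v] and [w] are
   distinct; this is the minus sign. *)
rewrite -{1}(finset.setD1K wL) !inversions1U ?inE ?eqxx ?(negPf vL) ?andbF //.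
rewrite !exprD; case: (ltngtP v w) => [_|_|/val_inj vw']; [ring|ring|].
by rewrite vw' eqxx in vw.
Qed.

Lemma generatorC v w :
  wedge (generator v) (generator w) = - wedge (generator w) (generator v) :> G.
Proof. by rewrite wedge_monomialC !cards1 /= expr1 scaleN1r. Qed.

Lemma wedge_genC v w a :
  wedge (generator v) (wedge (generator w) a) =
  - wedge (generator w) (wedge (generator v) a).
Proof. by rewrite !wedgeA generatorC wedgeNl. Qed.

(** A nonempty monomial is, up to a sign, one of its generators times a smaller monomial. Combined
    with [insl_wedge_gen] this reduces sign identities to checks on the unit and on one extra
    generator. *)
Lemma gen_ind (P : G -> Prop) :
  (forall k a b, P a -> P b -> P (k *: a + b)) -> P unit_grass ->
  (forall v a, P a -> P (wedge (generator v) a)) -> forall a, P a.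
Proof.
move=> PD P1 PE; have P0 : P 0.
  by have := PD (-1) _ _ P1 P1; rewrite scaleN1r addNr.
apply: grass_ind => // A; move: {2}#|A| (leqnn #|A|) => m.
elim: m A => [|m IH] A; first by rewrite leqn0 cards_eq0 => /eqP ->.
have [->|/finset.set0Pn[v vA]] := eqVneq A finset.set0; first by [].
rewrite (cardsD1 v) vA add1n ltnS => /IH Pm.
have -> : monomial A = (-1 : R[i]) ^+ inversions [set v] (A :\ v) *:
    wedge (generator v) (monomial (A :\ v)) + 0 :> G; last by apply: PD => //; exact: PE.
rewrite wedge_monomialE disjoints1 !inE eqxx /= finset.setD1K // addr0.
by rewrite scalerA -expr2 sqrr_sign scale1r.
Qed.

Lemma grade_unit : grade (unit_grass : G) = unit_grass.
Proof.
apply/ffunP => L; rewrite !ffunE; case: eqP => [->|_]; last exact: mulr0.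
rewrite cards0; exact: mulr1.
Qed.

Lemma grade_wedge_gen v a :
  grade (wedge (generator v) a) = - wedge (generator v) (grade a).
Proof.
apply/ffunP => L; rewrite [LHS]ffunE [RHS]ffunE !wedge_genE; case: ifP => vL.
  rewrite [X in - (_ *: X)]ffunE !scalerA -scaleNr; congr (_ *: _).
  by rewrite (cardsD1 v) vL exprS; ring.
by rewrite scaler0 oppr0.
Qed.

Lemma grade_insl v a : grade (insl v a) = - insl v (grade a).
Proof.
elim/gen_ind: a => [k a b IH IH'| |w a IH].
- by rewrite !(insl_linear, grade_linear) IH IH' opprD scalerN.
- by rewrite grade_unit insl_unit linear0 oppr0.
rewrite insl_wedge_gen linearB linearZ /= !grade_wedge_gen IH wedgeNr !opprK.
by rewrite [insl v (- _)]linearN /= insl_wedge_gen opprK.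
Qed.

(** Moving [v] to the left across [a] costs the parity sign of each homogeneous part of [a], and
    [grade] applies all these signs at once. *)
Lemma wedge_genr v a b :
  wedge a (wedge (generator v) b) = wedge (generator v) (wedge (grade a) b).
Proof.
elim/gen_ind: a => [k a a' IH IH'| |w a IH].
- by rewrite grade_linear !wedgePl wedgePr IH IH'.
- by rewrite grade_unit !wedge_unitl.
by rewrite -wedgeA IH wedge_genC grade_wedge_gen wedgeNl wedgeNr -wedgeA.
Qed.

Lemma insl_inslC v w a : insl v (insl w a) = - insl w (insl v a).
Proof.
elim/gen_ind: a => [k a b IH IH'| |x a IH].
- by rewrite !insl_linear IH IH' opprD scalerN.
- by rewrite !insl_unit !linear0.
rewrite !insl_wedge_gen !linearB !linearZ /= !insl_wedge_gen IH wedgeNr !opprK.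
by rewrite scalerN opprD addrCA.
Qed.

(** The occupation number operator of [v]; weighted by ghost signs and summed over [v] it becomes
    the ghost number operator in [number_ghost]. *)
Lemma wedge_gen_insl v a :
  wedge (generator v) (insl v a) =
  [ffun L : {set gen} => if v \in L then a L else 0].
Proof.
apply/ffunP => L; rewrite wedge_genE !ffunE; case: ifP => vL //.
by rewrite !inE eqxx /= finset.setD1K // scalerA -expr2 sqrr_sign scale1r.
Qed.

End Contraction.

(** * Expansion of the fibre product by the number of contractions *)

Section IteratedContraction.
Context {R : realType} {n : nat}.
Local Notation K := (R[i]^o).
Local Notation gen := ('I_(n + n)).
Local Notation G := (@grass n K).
Implicit Types (a b c : G) (v w x : gen) (A B L : {set gen}).

(* [v] is always contracted in the left factor against [dual v] in the right
   one: up k to low k is the operator P, low k to up k is Pstar. *)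
Definition dual v : gen :=
  match fintype.split v with inl a => low a | inr a => up a end.

Definition weight (kappa : R) v : R[i] :=
  match fintype.split v with
  | inl _ => kappa%:C%C
  | inr _ => (1 - kappa)%:C%C
  end.

Lemma split_up (k : 'I_n) : fintype.split (up k) = inl k.
Proof. exact: (unsplitK (inl k)). Qed.

Lemma split_low (k : 'I_n) : fintype.split (low k) = inr k.
Proof. exact: (unsplitK (inr k)). Qed.

Lemma dual_up (k : 'I_n) : dual (up k) = low k.
Proof. by rewrite /dual split_up. Qed.

Lemma dual_low (k : 'I_n) : dual (low k) = up k.
Proof. by rewrite /dual split_low. Qed.

Variant gen_spec : gen -> Type :=
  | GenUp k : gen_spec (up k)
  | GenLow k : gen_spec (low k).

Lemma genP v : gen_spec v.
Proof.
rewrite -(splitK v); case: (fintype.split v) => k; first exact: GenUp.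
exact: GenLow.
Qed.

Lemma dualK : involutive dual.
Proof. by move=> v; case: (genP v) => k; rewrite ?dual_up ?dual_low ?dual_up. Qed.

Lemma eq_dual v w : (dual v == w) = (v == dual w).
Proof. by rewrite (can2_eq dualK dualK). Qed.

Lemma reindex_dual (V : nmodType) (F : gen -> V) :
  \sum_v F v = \sum_v F (dual v).
Proof. by rewrite (reindex_inj (can_inj dualK)). Qed.

Lemma weight_up kappa (k : 'I_n) : weight kappa (up k) = kappa%:C%C.
Proof. by rewrite /weight split_up. Qed.

Lemma weight_low kappa (k : 'I_n) : weight kappa (low k) = (1 - kappa)%:C%C.
Proof. by rewrite /weight split_low. Qed.

(** This is why commutators with one contraction do not depend on the ordering parameter: the two
    orders contribute complementary weights. *)
Lemma weight_dual kappa v : weight kappa v + weight kappa (dual v) = 1.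
Proof.
case: (genP v) => k; rewrite ?dual_up ?dual_low weight_up weight_low.
  by rewrite -rmorphD /= addrC subrK.
by rewrite -rmorphD /= subrK.
Qed.

Lemma big_gen (V : nmodType) (F : gen -> V) :
  \sum_v F v = \sum_k F (up k) + \sum_k F (low k).
Proof. exact: big_split_ord. Qed.

Lemma tensor_bilinear : bilinear_for *:%R *:%R (@tensor R n).
Proof.
split=> [b k x y|a k x y]; apply/ffunP => p; rewrite !ffunE /GRing.scale /=; ring.
Qed.
HB.instance Definition _ := bilinear_isBilinear.Build _ _ _ _ _ _ (@tensor R n)
  tensor_bilinear.

Lemma mu_tensor a b : mu (tensor a b) = wedge a b.
Proof.
rewrite (bilinear_grass_pairE a b (conj wedge_linearl wedge_linearr)).
by apply: eq_bigr => p _; rewrite ffunE.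
Qed.

Lemma tensor_op_tensor (f h : {linear G -> G}) a b :
  tensor_op f h (tensor a b) = tensor (f a) (h b).
Proof.
have fh : bilinear_for *:%R *:%R (fun a b => tensor (f a) (h b)).
  by split=> [y k x x'|x k y y'] /=; rewrite linearP ?linearPl ?linearPr.
rewrite (bilinear_grass_pairE a b fh).
by apply: eq_bigr => p _; rewrite ffunE.
Qed.

Lemma Pop_tensor a b :
  Pop (tensor a b) = \sum_k tensor (insr (up k) a) (insl (low k) b).
Proof. by apply: eq_bigr => k _; rewrite -tensor_op_tensor. Qed.

Lemma Pstar_tensor a b :
  Pstar (tensor a b) = \sum_k tensor (insr (low k) a) (insl (up k) b).
Proof. by apply: eq_bigr => k _; rewrite -tensor_op_tensor. Qed.

Lemma tensor_op_linear f h : linear (@tensor_op R n f h).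
Proof.
move=> k x y; rewrite /tensor_op scaler_sumr -big_split; apply: eq_bigr => p _.
by rewrite !ffunE scalerDl scalerA.
Qed.

Lemma Pop_linear : linear (@Pop R n).
Proof.
move=> k x y; rewrite /Pop scaler_sumr -big_split; apply: eq_bigr => p _.
exact: tensor_op_linear.
Qed.

Lemma Pstar_linear : linear (@Pstar R n).
Proof.
move=> k x y; rewrite /Pstar scaler_sumr -big_split; apply: eq_bigr => p _.
exact: tensor_op_linear.
Qed.
HB.instance Definition _ := GRing.isLinear.Build R[i] _ _ _ (@Pop R n) Pop_linear.
HB.instance Definition _ :=
  GRing.isLinear.Build R[i] _ _ _ (@Pstar R n) Pstar_linear.

Lemma mu_linear : linear (@mu R n).
Proof.
move=> k x y; rewrite /mu scaler_sumr -big_split; apply: eq_bigr => p _.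
by rewrite !ffunE scalerDl scalerA.
Qed.
HB.instance Definition _ := GRing.isLinear.Build R[i] _ _ _ (@mu R n) mu_linear.

(* The r-th term of the product, without its scalar factor: see [circE]. *)
Fixpoint contr (kappa : R) (s : nat) a b : G :=
  if s is s'.+1 then
    \sum_v weight kappa v *: contr kappa s' (insr v a) (insl (dual v) b)
  else wedge a b.

Lemma contr_bilinear kappa s : bilinear_for *:%R *:%R (contr kappa s).
Proof.
elim: s => [|s [IHl IHr]] /=; first by split; [exact: wedge_linearl|exact: wedge_linearr].
split=> [b k x y|a k x y] /=; rewrite scaler_sumr -big_split /=;
  apply: eq_bigr => v _; rewrite scalerA [k * _]mulrC -scalerA -scalerDr;
  congr (_ *: _).
  by rewrite insr_linear; exact: IHl.
by rewrite insl_linear; exact: IHr.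
Qed.
HB.instance Definition _ kappa s := bilinear_isBilinear.Build _ _ _ _ _ _
  (contr kappa s) (contr_bilinear kappa s).

Lemma iter_linear (V : lmodType R[i]) (f : V -> V) r :
  linear f -> linear (iter r f).
Proof. by move=> fP; elim: r => [|r IH] k x y //=; rewrite IH fP. Qed.

(** Peeling off the innermost application of the exponent turns a decomposable tensor into a
    weighted sum of decomposable ones. The induction therefore runs over arbitrary [a] and [b], and
    no general tensor is ever inspected. *)
Lemma circE kappa a b s :
  circ kappa a b s = ((2 * 'i%C) ^+ s / s`!%:R) *: contr kappa s a b.
Proof.
rewrite /circ; congr (_ *: _); set Q := (X in iter s X _).
have Q_linear : linear Q.
  move=> k x y; rewrite /Q Pop_linear Pstar_linear.
  move: (Pop x) (Pop y) (Pstar x) (Pstar y) => Px Py Sx Sy.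
  move: (kappa%:C%C : R[i]) ((1 - kappa)%:C%C : R[i]) => p q.
  by rewrite !scalerDr !scalerA addrACA [p * k]mulrC [q * k]mulrC.
have iterQ_linear r : linear (iter r Q) := iter_linear r Q_linear.
pose iterQ r : {linear _ -> _} :=
  HB.pack (iter r Q) (GRing.isLinear.Build _ _ _ _ (iter r Q) (iterQ_linear r)).
elim: s a b => [|s IH] a b; first exact: mu_tensor.
have QE : Q (tensor a b) =
    \sum_v weight kappa v *: tensor (insr v a) (insl (dual v) b).
  rewrite /Q Pop_tensor Pstar_tensor big_gen !scaler_sumr.
  apply: (f_equal2 +%R); apply: eq_bigr => k _.
    by rewrite weight_up dual_up.
  by rewrite weight_low dual_low.
rewrite iterSr QE.
have -> : mu (iter s Q (\sum_v weight kappa v *: tensor (insr v a) (insl (dual v) b))) =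
    \sum_v weight kappa v *: mu (iter s Q (tensor (insr v a) (insl (dual v) b))).
  rewrite (linear_sum (iterQ s)) linear_sum; apply: eq_bigr => v _.
  by rewrite (linearZ_LR (iterQ s)) linearZ_LR.
by apply: eq_bigr => v _; rewrite IH.
Qed.

Lemma mu_Pop a b : mu (Pop (tensor a b)) =
  \sum_k wedge (insr (up k) a) (insl (dual (up k)) b).
Proof.
rewrite Pop_tensor (linear_sum (@mu R n)); apply: eq_bigr => k _.
by rewrite dual_up; exact: mu_tensor.
Qed.

Lemma mu_Pstar a b : mu (Pstar (tensor a b)) =
  \sum_k wedge (insr (low k) a) (insl (dual (low k)) b).
Proof.
rewrite Pstar_tensor (linear_sum (@mu R n)); apply: eq_bigr => k _.
by rewrite dual_low; exact: mu_tensor.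
Qed.

Lemma grass_bracketE a b :
  grass_bracket a b = 2 *: \sum_v wedge (insr v a) (insl (dual v) b).
Proof.
have muD (x y : @grass2 R n) : mu (x + y) = mu x + mu y by exact: linearD.
rewrite /grass_bracket muD [X in _ *: (X + _)]mu_Pop [X in _ *: (_ + X)]mu_Pstar.
by rewrite big_gen.
Qed.

End IteratedContraction.

(** * Contractions with single generators and with gamma *)

Section GhostCharge.
Context {R : realType} {n : nat}.
Local Notation K := (R[i]^o).
Local Notation gen := ('I_(n + n)).
Local Notation G := (@grass n K).
Implicit Types (kappa : R) (a b c : G) (v w x : gen) (A B L : {set gen}).

Local Notation one := (unit_grass : G).
Local Notation mult v a := (wedge (generator v) a).

Lemma genE v : generator v = mult v one.
Proof. by rewrite wedge_unitr. Qed.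

Lemma eq_up (k l : 'I_n) : (up k == up l) = (k == l).
Proof. by rewrite (inj_eq (@lshift_inj _ _)). Qed.

Lemma eq_low (k l : 'I_n) : (low k == low l) = (k == l).
Proof. by rewrite (inj_eq (@rshift_inj _ _)). Qed.

Lemma up_low (k l : 'I_n) : (up k == low l) = false.
Proof. exact: eq_lrshift. Qed.

Lemma low_up (k l : 'I_n) : (low k == up l) = false.
Proof. exact: eq_rlshift. Qed.

Lemma insr_wedge_gen v w a :
  insr v (mult w a) = (v == w)%:R *: grade a + mult w (insr v a).
Proof.
by rewrite !insrE grade_wedge_gen linearN /= insl_wedge_gen opprK wedgeNr.
Qed.

Lemma insr_unit v : insr v one = 0.
Proof. by rewrite insrE grade_unit insl_unit oppr0. Qed.

Lemma insl_gen v w : insl v (generator w) = (v == w)%:R *: one.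
Proof. by rewrite genE insl_wedge_gen insl_unit wedge0r subr0. Qed.

Lemma insr_gen v w : insr v (generator w) = (v == w)%:R *: one.
Proof. by rewrite genE insr_wedge_gen insr_unit wedge0r addr0 grade_unit. Qed.

Lemma grade_gen v : grade (generator v) = - generator v :> G.
Proof. by rewrite genE grade_wedge_gen grade_unit. Qed.

(** Supercommutativity for an odd left factor; [grade] spares splitting [b] into its parity
    parts. *)
Lemma wedge_oddl a b : grade a = - a -> wedge a b = wedge (grade b) a.
Proof.
move=> ga; elim/(@gen_ind R n): b => [k b b' IH IH'| |v b IH].
- by rewrite grade_linear wedgePl wedgePr IH IH'.
- by rewrite grade_unit wedge_unitl wedge_unitr.
by rewrite wedge_genr ga wedgeNl wedgeNr IH grade_wedge_gen wedgeNl wedgeA.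
Qed.

Lemma wedge_evenl a b : grade a = a -> wedge a b = wedge b a.
Proof.
move=> ga; elim/(@gen_ind R n): b => [k b b' IH IH'| |v b IH].
- by rewrite wedgePl wedgePr IH IH'.
- by rewrite wedge_unitl wedge_unitr.
by rewrite wedge_genr ga IH wedgeA.
Qed.

Lemma contrS kappa s a b : contr kappa s.+1 a b =
  \sum_v weight kappa v *: contr kappa s (insr v a) (insl (dual v) b).
Proof. by []. Qed.

Lemma contr0 kappa a b : contr kappa 0 a b = wedge a b.
Proof. by []. Qed.

Lemma contr0l kappa s b : contr kappa s 0 b = 0. Proof. exact: linear0l. Qed.
Lemma contr0r kappa s a : contr kappa s a 0 = 0. Proof. exact: linear0r. Qed.
Lemma contrZl kappa s k a b : contr kappa s (k *: a) b = k *: contr kappa s a b.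
Proof. exact: linearZl_LR. Qed.
Lemma contrZr kappa s k a b : contr kappa s a (k *: b) = k *: contr kappa s a b.
Proof. exact: linearZr_LR. Qed.

Lemma contrS_unitl kappa s b : contr kappa s.+1 one b = 0.
Proof. by rewrite contrS big1 // => v _; rewrite insr_unit contr0l scaler0. Qed.

Lemma contrS_unitr kappa s a : contr kappa s.+1 a one = 0.
Proof. by rewrite contrS big1 // => v _; rewrite insl_unit contr0r scaler0. Qed.

Lemma contrS_genl kappa s v b : contr kappa s.+1 (generator v) b =
  weight kappa v *: contr kappa s one (insl (dual v) b).
Proof.
rewrite contrS (bigD1 v) //= big1 => [|w /negPf wv]; rewrite insr_gen contrZl.
  by rewrite eqxx scale1r addr0.
by rewrite wv scale0r scaler0.
Qed.

Lemma contrS_genr kappa s v a : contr kappa s.+1 a (generator v) =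
  weight kappa (dual v) *: contr kappa s (insr (dual v) a) one.
Proof.
rewrite contrS (bigD1 (dual v)) //= big1 => [|w /negPf wv]; rewrite insl_gen contrZr.
  by rewrite dualK eqxx scale1r addr0.
by rewrite eq_dual wv scale0r scaler0.
Qed.

Lemma contr1_genl kappa v b :
  contr kappa 1 (generator v) b = weight kappa v *: insl (dual v) b.
Proof. by rewrite contrS_genl /= wedge_unitl. Qed.

Lemma contr1_genr kappa v a :
  contr kappa 1 a (generator v) = weight kappa (dual v) *: insr (dual v) a.
Proof. by rewrite contrS_genr /= wedge_unitr. Qed.

(** The first contraction consumes the generator and leaves a multiple of the unit, which admits no
    second one. *)
Lemma contr2_genl kappa s v b : contr kappa s.+2 (generator v) b = 0.
Proof. by rewrite contrS_genl contrS_unitl scaler0. Qed.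

Lemma contr2_genr kappa s v a : contr kappa s.+2 a (generator v) = 0.
Proof. by rewrite contrS_genr contrS_unitr scaler0. Qed.

Lemma contr_up_up kappa s (k l : 'I_n) :
  contr kappa s.+1 (generator (up k)) (generator (up l)) = 0.
Proof.
case: s => [|s]; last exact: contr2_genl.
by rewrite contr1_genl dual_up insl_gen low_up scale0r scaler0.
Qed.

Definition gsign v : int :=
  match fintype.split v with inl _ => 1 | inr _ => -1 end.

Lemma gsign_up (k : 'I_n) : gsign (up k) = 1.
Proof. by rewrite /gsign split_up. Qed.

Lemma gsign_low (k : 'I_n) : gsign (low k) = -1.
Proof. by rewrite /gsign split_low. Qed.

Lemma gsign_dual v : gsign (dual v) = - gsign v.
Proof. by case: (genP v) => k; rewrite ?dual_up ?dual_low gsign_up gsign_low ?opprK. Qed.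

Lemma ghostE L : ghost L = \sum_(v in L) gsign v.
Proof.
rewrite big_mkcond big_gen /ghost !cardsE -!sum1_card -[X in X - _]natz -[X in _ - X]natz !natr_sum.
rewrite -sumrN; congr (_ + _); rewrite [LHS]big_mkcond; apply: eq_bigr => k _.
  by rewrite gsign_up; case: ifP.
  by rewrite gsign_low; case: ifP.
Qed.

Lemma number_ghost a :
  \sum_v (gsign v)%:~R *: mult v (insl v a) =
  [ffun L : {set gen} => (ghost L)%:~R * a L].
Proof.
apply/ffunP => L; rewrite sum_ffunE ffunE ghostE rmorph_sum /= mulr_suml.
rewrite [RHS]big_mkcond; apply: eq_bigr => v _.
by rewrite wedge_gen_insl !ffunE; case: ifP => _; rewrite ?scaler0.
Qed.

Definition gamma_grass : G :=
  2^-1 *: \sum_(k < n) wedge (generator (up k)) (generator (low k)).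

(** Each generator is paired in gamma with its dual. For [low k] the insertion first passes e^k, and
    this sign is the ghost sign. *)
Lemma insl_gamma v :
  insl v gamma_grass = (2^-1 * (gsign v)%:~R) *: generator (dual v).
Proof.
rewrite /gamma_grass linearZ linear_sum /= -scalerA; congr (_ *: _).
have sumE (F : 'I_n -> G) (k : 'I_n) c : F k = c ->
    (forall l, l != k -> F l = 0) -> \sum_l F l = c.
  by move=> <- F0; rewrite (bigD1 k) //= big1 ?addr0.
case: (genP v) => k; apply: (sumE _ k) => [|l /negPf kl];
  rewrite insl_wedge_gen insl_gen ?dual_up ?dual_low ?gsign_up ?gsign_low
    ?eq_up ?eq_low ?up_low ?low_up ?eqxx.
- by rewrite !scale1r scale0r wedge0r subr0.
- by rewrite eq_sym kl !scale0r wedge0r subr0.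
- by rewrite scale0r sub0r scale1r wedge_unitr scaleN1r.
- by rewrite eq_sym kl !scale0r wedge0r subr0.
Qed.

Lemma grade_gamma : grade gamma_grass = gamma_grass.
Proof.
rewrite /gamma_grass linearZ linear_sum /=; congr (_ *: _); apply: eq_bigr => k _.
by rewrite grade_wedge_gen grade_gen wedgeNr opprK.
Qed.

Lemma insr_gamma v :
  insr v gamma_grass = - (2^-1 * (gsign v)%:~R) *: generator (dual v).
Proof. by rewrite insrE grade_gamma insl_gamma scaleNr. Qed.

(** The factor 2 of the bracket cancels the 1/2 of gamma. Each contraction replaces a generator by
    itself, up to its ghost sign, so that the sum counts ghosts. *)
Lemma gamma_bracket a :
  grass_bracket gamma_grass a = [ffun L : {set gen} => (ghost L)%:~R * a L].
Proof.
rewrite -number_ghost grass_bracketE [in RHS]reindex_dual scaler_sumr.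
apply: eq_bigr => v _; rewrite insr_gamma wedgeZl scalerA gsign_dual rmorphN /=.
by congr (_ *: _); field.
Qed.

Lemma contr_gamma_comm0 kappa a :
  contr kappa 0 gamma_grass a = contr kappa 0 a gamma_grass.
Proof. exact/wedge_evenl/grade_gamma. Qed.

(** After reindexing by [dual], both orders give multiples of the same operator, multiplication by
    [v] after insertion of [v]. The coefficients have opposite signs and complementary weights, so
    the difference no longer contains [kappa]. *)
Lemma contr_gamma_comm1 kappa a :
  contr kappa 1 gamma_grass a - contr kappa 1 a gamma_grass =
  2^-1 *: [ffun L : {set gen} => (ghost L)%:~R * a L].
Proof.
rewrite -number_ghost !contrS [X in X - _]reindex_dual -sumrB scaler_sumr; apply: eq_bigr => v _.
rewrite insl_gamma insr_gamma !dualK gsign_dual.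
rewrite !contr0 wedgeZl wedgeZr [X in wedge (insr _ _) X]genE.
rewrite [X in _ - _ *: (_ *: X)]wedge_genr.
rewrite wedge_unitr insrE linearN /= grade_insl gradeK opprK.
rewrite !scalerA -scalerBl.
congr (_ *: _); rewrite rmorphN /= -[RHS]mul1r -(weight_dual kappa v); ring.
Qed.

(** Two contractions exhaust gamma, and the orders agree term by term: both carry the product of the
    weights of [v] and its dual, and two right insertions equal the left ones taken in the opposite
    order. *)
Lemma contr_gamma_comm2 kappa a :
  contr kappa 2 gamma_grass a = contr kappa 2 a gamma_grass.
Proof.
rewrite ![in LHS]contrS ![in RHS]contrS; apply: eq_bigr => v _.
rewrite insr_gamma insl_gamma !dualK contrZl contrZr contr1_genl contr1_genr dualK.
rewrite gsign_dual rmorphN mulrN !insrE; congr (_ *: (_ *: (_ *: _))).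
by rewrite linearN /= grade_insl gradeK !opprK insl_inslC.
Qed.

Lemma contr_gamma_comm3 kappa s a :
  contr kappa s.+3 gamma_grass a = contr kappa s.+3 a gamma_grass.
Proof.
rewrite ![in LHS]contrS ![in RHS]contrS; apply: eq_bigr => v _.
by rewrite insr_gamma insl_gamma contrZl contrZr contr2_genl contr2_genr !scaler0.
Qed.

End GhostCharge.

(** * The cubic charge Omega *)

Section BRSTCharge.
Context {R : realType} {n : nat}.
Local Notation K := (R[i]^o).
Local Notation gen := ('I_(n + n)).
Local Notation G := (@grass n K).
Implicit Types (kappa : R) (p q : G) (v w x : gen) (A B L : {set gen}) (a b c d k l : 'I_n).

Local Notation one := (unit_grass : G).
Local Notation mult v a := (wedge (generator v) a).

Context (f : 'I_n -> 'I_n -> 'I_n -> R[i]).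
Hypothesis f_skew : forall c a b, f c a b = - f c b a.
Hypothesis f_jacobi : forall l a b d,
  \sum_k (f k a b * f l k d + f k b d * f l k a + f k d a * f l k b) = 0.

(** Nesting the factors to the right and ending with the unit lets [insl_wedge_gen] and [insl_unit]
    evaluate every insertion. The constants [f] are abstract complex numbers subject only to skew
    symmetry and Jacobi. *)
Definition omega_grass : G := - 4^-1 *:
  \sum_a \sum_b \sum_c f c a b *: mult (up a) (mult (up b) (mult (low c) one)).

Lemma grade_omega : grade omega_grass = - omega_grass.
Proof.
rewrite /omega_grass linearZ linear_sum -[RHS]scalerN -sumrN; congr (_ *: _).
apply: eq_bigr => a _; rewrite linear_sum -sumrN; apply: eq_bigr => b _.
rewrite linear_sum -sumrN; apply: eq_bigr => c _.
by rewrite linearZ /= !grade_wedge_gen grade_unit !wedgeNr opprK scalerN.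
Qed.

Lemma sum_delta (W : lmodType R[i]) (F : 'I_n -> W) (k : 'I_n) :
  \sum_l ((k == l)%:R : R[i]) *: F l = F k.
Proof.
rewrite (bigD1 k) //= big1 ?addr0 ?eqxx ?scale1r // => l /negPf lk.
by rewrite eq_sym lk scale0r.
Qed.

Lemma insl_low_omega (k : 'I_n) : insl (low k) omega_grass =
  - 4^-1 *: \sum_a \sum_b f k a b *: mult (up a) (mult (up b) one).
Proof.
rewrite /omega_grass linearZ /=; congr (_ *: _); rewrite linear_sum /=.
apply: eq_bigr => a _; rewrite linear_sum /=; apply: eq_bigr => b _.
rewrite linear_sum /= -[RHS](sum_delta (fun c => f c a b *: mult (up a) (mult (up b) one))).
apply: eq_bigr => c _; rewrite linearZ /= !insl_wedge_gen !low_up !scale0r !sub0r.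
rewrite insl_unit !wedgeNr opprK wedge0r subr0 eq_low !wedgeZr.
by rewrite !scalerA mulrC.
Qed.

Lemma insl_up_uul (k a b c : 'I_n) :
  insl (up k) (mult (up a) (mult (up b) (mult (low c) one))) =
  (k == a)%:R *: mult (up b) (mult (low c) one) -
  (k == b)%:R *: mult (up a) (mult (low c) one).
Proof.
have lowc : insl (up k) (mult (low c) one) = 0.
  by rewrite insl_wedge_gen up_low insl_unit wedge0r subr0 scale0r.
rewrite insl_wedge_gen [insl _ (mult (up b) _)]insl_wedge_gen lowc [mult (up b) 0]wedge0r.
  by rewrite [X in mult (up a) X]subr0 wedgeZr !eq_up.
Qed.

(** The insertion can hit either of the two e^a factors. By skew symmetry of [f] both contributions
    agree, which turns -1/4 into -1/2. *)
Lemma insl_up_omega (k : 'I_n) : insl (up k) omega_grass =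
  - 2^-1 *: \sum_b \sum_c f c k b *: mult (up b) (mult (low c) one).
Proof.
pose X a b c : G := f c a b *: mult (up b) (mult (low c) one).
have -> : insl (up k) omega_grass = - 4^-1 *:
    \sum_a \sum_b \sum_c (((k == a)%:R : R[i]) *: X a b c +
                          ((k == b)%:R : R[i]) *: X b a c).
  rewrite /omega_grass linearZ /=; congr (_ *: _); rewrite linear_sum /=.
  apply: eq_bigr => a _; rewrite linear_sum /=; apply: eq_bigr => b _.
  rewrite linear_sum /=; apply: eq_bigr => c _.
  rewrite linearZ /= insl_up_uul scalerBr /X.
  rewrite [f c b a]f_skew scaleNr scalerN.
  rewrite [X in X - _ = _]scalerA [X in _ - X = _]scalerA.
  by rewrite [X in _ = X - _]scalerA [X in _ = _ - X]scalerA ![f c a b * _]mulrC.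
have -> : \sum_a \sum_b \sum_c (((k == a)%:R : R[i]) *: X a b c +
                          ((k == b)%:R : R[i]) *: X b a c) =
    (2 : R[i]) *: \sum_b \sum_c X k b c.
  under eq_bigr do under eq_bigr do rewrite big_split.
  under eq_bigr do rewrite big_split.
  rewrite big_split /= [X in _ + X]exchange_big /= -mulr2n -scaler_nat.
  congr (_ *: _).
  rewrite -[RHS](sum_delta (fun a => \sum_b \sum_c X a b c)).
  apply: eq_bigr => a _; rewrite scaler_sumr; apply: eq_bigr => b _.
  by rewrite scaler_sumr.
rewrite scalerA; congr (_ *: _).
by field.
Qed.

Lemma insl_low_low_omega (k l : 'I_n) : insl (low k) (insl (low l) omega_grass) = 0.
Proof.
rewrite insl_low_omega linearZ linear_sum /= big1 ?scaler0 // => a _.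
rewrite linear_sum big1 // => b _; rewrite linearZ /= !insl_wedge_gen !low_up.
by rewrite insl_unit wedge0r !scale0r subrr wedge0r subrr scaler0.
Qed.

Lemma grade_insl_omega v : grade (insl v omega_grass) = insl v omega_grass.
Proof. by rewrite grade_insl grade_omega linearN opprK. Qed.

Lemma insr_omega v : insr v omega_grass = insl v omega_grass.
Proof. by rewrite insrE grade_omega linearN opprK. Qed.

Lemma grade_insl2_omega v w :
  grade (insl w (insl v omega_grass)) = - insl w (insl v omega_grass).
Proof. by rewrite grade_insl grade_insl_omega. Qed.

(** Omega is odd, so its first right insertion equals the left one; the remainder is even, so the
    second one differs by a sign. *)
Lemma insr2_omega v w :
  insr w (insr v omega_grass) = - insl w (insl v omega_grass).
Proof. by rewrite insr_omega insrE grade_insl_omega. Qed.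

(* Two of any three generators are of the same kind. *)
Lemma insl3_omega v w x : insl x (insl w (insl v omega_grass)) = 0 \/
  insl (dual x) (insl (dual w) (insl (dual v) omega_grass)) = 0.
Proof.
have two_low k l y : insl y (insl (low k) (insl (low l) omega_grass)) = 0.
  by rewrite insl_low_low_omega linear0.
have low_mid k l y : insl (low k) (insl y (insl (low l) omega_grass)) = 0.
  by rewrite insl_inslC two_low oppr0.
have low_last k l y : insl (low k) (insl (low l) (insl y omega_grass)) = 0.
  by rewrite [insl (low l) _]insl_inslC linearN /= low_mid oppr0.
case: (genP v) => k; case: (genP w) => l; case: (genP x) => m;
  rewrite ?dual_up ?dual_low;
  by [left; exact: two_low|left; exact: low_mid|left; exact: low_last
     |right; exact: two_low|right; exact: low_mid|right; exact: low_last].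
Qed.

Lemma cyclic_mult a b c p :
  mult (up a) (mult (up b) (mult (up c) p)) = mult (up b) (mult (up c) (mult (up a) p)).
Proof. by rewrite wedge_genC [mult (up a) (mult (up c) _)]wedge_genC wedgeNr opprK. Qed.

(* The Jacobi identity: multiplied by 3, the sum becomes a cyclic sum over the
   three wedge factors e^a, e^b, e^d. *)
Lemma sum_insl_omega :
  \sum_k wedge (insl (low k) omega_grass) (insl (up k) omega_grass) = 0.
Proof.
pose Y l a b d : G := mult (up a) (mult (up b) (mult (up d) (mult (low l) one))).
pose T l a b d : R[i] := \sum_k f k a b * f l k d.
have -> : \sum_k wedge (insl (low k) omega_grass) (insl (up k) omega_grass) =
    8^-1 *: \sum_l \sum_a \sum_b \sum_d T l a b d *: Y l a b d.
  transitivity ((8^-1 : R[i]) *: \sum_k \sum_a \sum_b \sum_d \sum_l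
      (f k a b * f l k d) *: Y l a b d).
    rewrite scaler_sumr; apply: eq_bigr => k _.
    rewrite insl_low_omega insl_up_omega wedgeZl wedgeZr scalerA.
    have -> : - 4^-1 * - 2^-1 = 8^-1 :> R[i] by field.
    congr (_ *: _); rewrite wedge_suml; apply: eq_bigr => a _.
    rewrite wedge_suml; apply: eq_bigr => b _; rewrite wedge_sumr.
    apply: eq_bigr => d _; rewrite wedge_sumr; apply: eq_bigr => l _.
    by rewrite wedgeZl wedgeZr scalerA -!wedgeA wedge_unitl.
  congr (_ *: _); rewrite exchange_big; under eq_bigr do rewrite exchange_big.
  under eq_bigr do under eq_bigr do rewrite exchange_big.
  under eq_bigr do under eq_bigr do under eq_bigr do rewrite exchange_big.
  rewrite [RHS]exchange_big; apply: eq_bigr => a _.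
  rewrite [RHS]exchange_big; apply: eq_bigr => b _.
  rewrite [RHS]exchange_big; apply: eq_bigr => d _.
  by apply: eq_bigr => l _; rewrite scaler_suml.
rewrite big1 ?scaler0 // => l _.
have cyc : forall F : 'I_n -> 'I_n -> 'I_n -> G,
    \sum_a \sum_b \sum_d F a b d = \sum_a \sum_b \sum_d F b d a.
  move=> F; rewrite [RHS]exchange_big; apply: eq_bigr => a _.
  by rewrite [RHS]exchange_big.
set S := \sum_a _.
have S1 : S = \sum_a \sum_b \sum_d T l b d a *: Y l a b d.
  rewrite /S cyc; apply: eq_bigr => a _; apply: eq_bigr => b _.
  by apply: eq_bigr => d _; congr (_ *: _); rewrite /Y -cyclic_mult.
have S2 : S = \sum_a \sum_b \sum_d T l d a b *: Y l a b d.
  rewrite S1 cyc; apply: eq_bigr => a _; apply: eq_bigr => b _.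
  by apply: eq_bigr => d _; congr (_ *: _); rewrite /Y -cyclic_mult.
have : (3 : R[i]) *: S = 0.
  rewrite scaler_nat mulrSr mulr2n {2}S1 {2}S2 -!big_split; apply: big1 => a _ /=.
  rewrite -!big_split; apply: big1 => b _ /=; rewrite -!big_split.
  apply: big1 => d _ /=; by rewrite -!scalerDl -!big_split /= f_jacobi scale0r.
by move/eqP; rewrite scaler_eq0 pnatr_eq0 => /eqP.
Qed.

Lemma wedge_odd_odd p q :
  grade p = - p -> grade q = - q -> wedge q p = - wedge p q.
Proof. by move=> gp gq; rewrite (wedge_oddl p gq) gp wedgeNl. Qed.

Lemma contr_omega kappa s : contr kappa s omega_grass omega_grass = 0.
Proof.
case: s => [|[|[|s]]].
- rewrite contr0; apply: eq_oppr_eq0.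
  by rewrite -wedgeNl -grade_omega; apply: wedge_oddl; exact: grade_omega.
(* The summands for [up k] and [low k] contain the same two even factors in opposite order, with
   weights kappa and 1 - kappa, and merge into one term of the Jacobi sum. *)
- rewrite contrS big_gen -[RHS]sum_insl_omega -big_split; apply: eq_bigr => k _ /=.
  rewrite weight_up weight_low dual_up dual_low !insr_omega.
  rewrite [X in _ *: X + _]wedge_evenl ?grade_insl_omega // -scalerDl.
  by rewrite -rmorphD /= addrC subrK scale1r.
- pose H v w := insl w (insl v omega_grass).
  pose U v w := (weight kappa v * weight kappa w) *:
    wedge (H v w) (H (dual v) (dual w)).
  have -> : contr kappa 2 omega_grass omega_grass = - \sum_v \sum_w U v w.
    rewrite contrS -sumrN; apply: eq_bigr => v _.
    rewrite contrS scaler_sumr -sumrN; apply: eq_bigr => w _.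
    by rewrite insr2_omega contr0 wedgeNl !scalerN scalerA.
  (* The weights are exchanged harmlessly: if v and w are of the same kind, then
     one of the two factors contracts twice with some e^c, which gives 0. *)
  have U_dual v w : U (dual v) (dual w) = - U v w.
    have -> : U (dual v) (dual w) = - ((weight kappa (dual v) * weight kappa (dual w)) *:
        wedge (H v w) (H (dual v) (dual w))).
      rewrite -scalerN /U !dualK; congr (_ *: _).
      by apply: wedge_odd_odd; exact: grade_insl2_omega.
    congr (- _); rewrite /U.
    case: (genP v) => k; case: (genP w) => l; rewrite ?dual_up ?dual_low.
    - by rewrite [H (low k) _]insl_low_low_omega wedge0r !scaler0.
    - by rewrite !weight_up !weight_low mulrC.
    - by rewrite !weight_up !weight_low mulrC.
    - by rewrite [H (low k) _]insl_low_low_omega wedge0l !scaler0.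
  have -> : \sum_v \sum_w U v w = 0; last exact: oppr0.
  apply: eq_oppr_eq0; rewrite -sumrN reindex_dual; apply: eq_bigr => v _.
  by rewrite -sumrN reindex_dual; apply: eq_bigr => w _.
rewrite contrS big1 // => v _; rewrite contrS big1 ?scaler0 // => w _.
rewrite contrS big1 ?scaler0 // => x _; rewrite insr2_omega insrE.
rewrite [grade (- _)]linearN /= grade_insl2_omega opprK.
by have [->|->] := insl3_omega v w x; rewrite ?oppr0 ?contr0l ?contr0r scaler0.
Qed.

(** The sum of both orders is the supercommutator of two odd elements. Without contraction it
    cancels; with one, the same insertion occurs with complementary weights; a generator allows no
    second contraction. *)
Lemma contr_omega_up kappa s (a : 'I_n) :
  contr kappa s omega_grass (generator (up a)) +
  contr kappa s (generator (up a)) omega_grass =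
  if s == 1%N then insl (low a) omega_grass else 0.
Proof.
case: s => [|[|s]]; last by rewrite contr2_genl contr2_genr addr0.
  by rewrite !contr0 wedge_oddl ?grade_omega // grade_gen wedgeNl addNr.
rewrite contr1_genl contr1_genr dual_up insr_omega -scalerDl.
by rewrite weight_up weight_low -rmorphD /= subrK scale1r.
Qed.

Lemma insl_up_uu k a b : insl (up k) (mult (up a) (mult (up b) one)) =
  (k == a)%:R *: generator (up b) - (k == b)%:R *: generator (up a).
Proof.
by rewrite insl_wedge_gen -!genE insl_gen wedgeZr -genE !eq_up.
Qed.

(** The origin of the trace form: contracting e_c with one of the two e^a sets two indices of [f]
    equal. The two positions give equal terms, and a last use of skew symmetry removes the sign of
    -1/2. *)
Lemma Delta_omega : Delta omega_grass =
  \sum_a (2^-1 * \sum_b f b a b) *: generator (up a).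
Proof.
pose Y k b : G := f k k b *: generator (up b).
have insl2 k : insl (up k) (insl (low k) omega_grass) = - 2^-1 *: \sum_b Y k b.
  rewrite insl_low_omega linearZ /=.
  have -> : insl (up k) (\sum_a \sum_b f k a b *: mult (up a) (mult (up b) one)) =
      \sum_a (\sum_b (k == a)%:R *: (f k a b *: generator (up b)) +
              \sum_b (k == b)%:R *: (f k b a *: generator (up a))).
    rewrite linear_sum; apply: eq_bigr => a _; rewrite /= linear_sum -big_split.
    apply: eq_bigr => b _; rewrite linearZ /= insl_up_uu scalerBr.
    rewrite [f k b a]f_skew scaleNr scalerN.
    rewrite [X in X - _ = _]scalerA [X in _ - X = _]scalerA.
    by rewrite [X in _ = X - _]scalerA [X in _ = _ - X]scalerA ![f k a b * _]mulrC.
  rewrite big_split /= [X in X + _]exchange_big /=.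
  have -> : \sum_b \sum_a (k == a)%:R *: (f k a b *: generator (up b)) = \sum_b Y k b.
    by apply: eq_bigr => b _; rewrite (sum_delta (fun a => f k a b *: generator (up b))).
  rewrite -[X in _ *: X]mulr2n -[X in _ *: X = _]scaler_nat scalerA; congr (_ *: _); by field.
rewrite /Delta (eq_bigr (fun k => - 2^-1 *: \sum_b Y k b)) => [|k _]; last exact: insl2.
rewrite -scaler_sumr exchange_big scaler_sumr; apply: eq_bigr => b _ /=.
rewrite /Y -scaler_suml scalerA; congr (_ *: _).
rewrite mulNr -mulrN -sumrN; congr (_ * _); apply: eq_bigr => k _.
by rewrite [in RHS]f_skew.
Qed.

Lemma Delta_generator v : Delta (generator v : G) = 0.
Proof.
rewrite /Delta big1 // => k _; rewrite /ivec /icov insl_gen.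
by rewrite [insl (up k) _]linearZ /= insl_unit scaler0.
Qed.

End BRSTCharge.

(** * Structure constants *)

Section StructureConstants.
Context {R : realType} {g : vectType R} (br : g -> g -> g) {n : nat} (e : n.-tuple g).
Hypothesis lie_br : lie_bracket br.
Hypothesis basis_e : basis_of fullv e.
Implicit Types (x y z : g) (a b c d k l : 'I_n).
Local Notation sc := (structure_const br e).

Lemma brPl (k : R) x y z : br (k *: x + y) z = k *: br x z + br y z.
Proof. by case: lie_br. Qed.

Lemma brPr (k : R) x y z : br z (k *: x + y) = k *: br z x + br z y.
Proof. by case: lie_br. Qed.

Lemma brC x y : br x y = - br y x.
Proof.
case: lie_br => _ _ brxx _; apply/eqP; rewrite -addr_eq0.
have := brxx (1 *: x + y); rewrite brPl !brPr !scale1r !brxx add0r addr0.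
by move=> ->.
Qed.

Lemma br_linearl z : linear (br^~ z).
Proof. by move=> k x y; exact: brPl. Qed.

Lemma br_suml (F : 'I_n -> R) z :
  br (\sum_k F k *: e`_k) z = \sum_k F k *: br e`_k z.
Proof.
pose f := HB.pack_for {linear g -> g} (br^~ z)
  (GRing.isLinear.Build _ _ _ _ (br^~ z) (br_linearl z)).
rewrite -[LHS]/(f _) linear_sum; apply: eq_bigr => k _; exact: linearZ.
Qed.

Lemma br_basis a b : br e`_a e`_b = \sum_c sc c a b *: e`_c.
Proof. exact: (coord_basis basis_e (memvf _)). Qed.

Lemma sc_skew c a b : sc c a b = - sc c b a.
Proof. by rewrite /structure_const brC linearN. Qed.

Lemma sc_br l a b d : coord e l (br (br e`_a e`_b) e`_d) = \sum_k sc k a b * sc l k d.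
Proof.
rewrite br_basis br_suml linear_sum; apply: eq_bigr => k _.
by rewrite linearZ.
Qed.

Lemma sc_jacobi l a b d :
  \sum_k (sc k a b * sc l k d + sc k b d * sc l k a + sc k d a * sc l k b) = 0.
Proof.
rewrite !big_split /= -!sc_br -!linearD /=.
rewrite (brC (br e`_a e`_b)) (brC (br e`_b e`_d)) (brC (br e`_d e`_a)) -!opprD.
case: lie_br => _ _ _ jac; rewrite linearN /=.
by have -> : br e`_d (br e`_a e`_b) + br e`_a (br e`_b e`_d) +
    br e`_b (br e`_d e`_a) = 0; [exact: jac|rewrite linear0 oppr0].
Qed.

Lemma trace_form_sc a : trace_form br e e`_a = 2^-1 * \sum_b sc b a b.
Proof. by congr (_ * _); apply: eq_bigr => b _; rewrite mxE. Qed.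

(* chi vanishes on brackets. *)
Lemma sum_sc_trace a b : \sum_c sc c a b * trace_form br e e`_c = 0.
Proof.
have h : \sum_d \sum_k sc k a b * sc d k d = 0.
  have : \sum_d \sum_k (sc k a b * sc d k d + sc k b d * sc d k a +
      sc k d a * sc d k b) = 0 by apply: big1 => d _; exact: sc_jacobi.
  (* Tracing Jacobi, the last two terms cancel after exchanging d and k. *)
  under eq_bigr do rewrite !big_split.
  rewrite !big_split /= -addrA [X in _ + (_ + X)]exchange_big /= -big_split.
  rewrite [X in _ + X]big1 ?addr0 // => d _; rewrite -big_split big1 // => k _ /=.
  by rewrite [sc k b d]sc_skew mulNr [X in _ + X]mulrC addNr.
transitivity (2^-1 * \sum_d \sum_k sc k a b * sc d k d); last by rewrite h mulr0.
rewrite exchange_big mulr_sumr; apply: eq_bigr => c _.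
by rewrite trace_form_sc mulrCA; congr (_ * _); rewrite mulr_sumr.
Qed.

End StructureConstants.

(** * Star products on the BRST algebra *)

Lemma Cinf_scalerAl (R : realType) (M : manifold R) (k : R[i]) (f h : Cinf M) :
  k *: (f * h) = (k *: f) * h.
Proof. by apply: val_inj; apply/funext => x; exact: (mulrA k (f x) (h x)). Qed.

Section StarProduct.
Context {R : realType} {M : manifold R} {n : nat}.
Context (C : nat -> Cinf M -> Cinf M -> Cinf M).
Hypothesis C_bilinear : forall r (a : R[i]) (f g h : Cinf M),
  C r (a *: f + g) h = a *: C r f h + C r g h /\
  C r h (a *: f + g) = a *: C r h f + C r h g.
Hypothesis C_0 : forall f g, C 0%N f g = f * g.
Hypothesis C_unit : forall r f (a : R[i]),
  C r.+1 f (a *: (1 : Cinf M)) = 0 /\ C r.+1 (a *: (1 : Cinf M)) f = 0.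

Local Notation K := (R[i]^o).
Local Notation gen := ('I_(n + n)).
Local Notation G := (@grass n K).
Local Notation brst := (@grass n (Cinf M)).
Local Notation series := (nat -> Cinf M).
Local Notation one := (lambda0 (1 : Cinf M)).
Implicit Types (kappa : R) (F H : series) (p q : G) (u v w : nat -> brst).

Lemma starserPl (k : R[i]) F F' H :
  star_series C (k *: F + F') H = k *: star_series C F H + star_series C F' H.
Proof.
apply/funext => r; rewrite /star_series !fctE scaler_sumr -big_split.
apply: eq_bigr => s _ /=; rewrite scaler_sumr -big_split; apply: eq_bigr => j _ /=.
by rewrite (C_bilinear _ _ _ _ _).1.
Qed.

Lemma starserPr (k : R[i]) F F' H :
  star_series C H (k *: F + F') = k *: star_series C H F + star_series C H F'.
Proof.
apply/funext => r; rewrite /star_series !fctE scaler_sumr -big_split.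
apply: eq_bigr => s _ /=; rewrite scaler_sumr -big_split; apply: eq_bigr => j _ /=.
by rewrite (C_bilinear _ _ _ _ _).2.
Qed.

Lemma starser0l H : star_series C 0 H = 0.
Proof. by have := starserPl (-1) 0 0 H; rewrite scaler0 addr0 scaleN1r addNr. Qed.

Lemma starser0r H : star_series C H 0 = 0.
Proof. by have := starserPr (-1) 0 0 H; rewrite scaler0 addr0 scaleN1r addNr. Qed.

Lemma starserDl F F' H :
  star_series C (F + F') H = star_series C F H + star_series C F' H.
Proof. by rewrite -{1}[F]scale1r starserPl scale1r. Qed.

Lemma starserDr F F' H :
  star_series C H (F + F') = star_series C H F + star_series C H F'.
Proof. by rewrite -{1}[F]scale1r starserPr scale1r. Qed.

Lemma starser_scalarl (c : nat -> R[i]) H :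
  star_series C (fun r => c r *: (1 : Cinf M)) H = fun r => \sum_(j < r.+1) c j *: H (r - j)%N.
Proof.
apply/funext => r; rewrite /star_series big_ord_recl /= [X in _ + X]big1 ?addr0.
  rewrite subn0; apply: eq_bigr => j _.
  by rewrite C_0 -Cinf_scalerAl mul1r.
by move=> s _; apply: big1 => j _; exact: (C_unit _ _ _).2.
Qed.

(** Series of constants are central: every [C r.+1] kills them and [C 0] is commutative, so both
    products are the Cauchy product. Adding constants to a momentum map thus leaves its commutators
    unchanged. *)
Lemma starser_scalarr (c : nat -> R[i]) H :
  star_series C H (fun r => c r *: (1 : Cinf M)) = star_series C (fun r => c r *: (1 : Cinf M)) H.
Proof.
apply/funext => r; rewrite starser_scalarl /star_series big_ord_recl /= [X in _ + X]big1 ?addr0.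
  rewrite subn0 [RHS](reindex_inj rev_ord_inj); apply: eq_bigr => j _ /=.
  have jr : (j <= r)%N by rewrite -ltnS.
  by rewrite C_0 subSS (subKn jr) mulrC -Cinf_scalerAl mul1r.
by move=> s _; apply: big1 => j _; exact: (C_unit _ _ _).1.
Qed.

Lemma lambda0_scalar :
  one = fun r => ((r == 0%N)%:R : R[i]) *: (1 : Cinf M).
Proof. by apply/funext => -[|r]; rewrite /= ?scale1r ?scale0r. Qed.

Lemma starser1l H : star_series C one H = H.
Proof.
rewrite lambda0_scalar starser_scalarl; apply/funext => r.
rewrite big_ord_recl /= subn0 scale1r big1 ?addr0 // => j _.
by rewrite scale0r.
Qed.

Lemma starser1r H : star_series C H one = H.
Proof. by rewrite lambda0_scalar starser_scalarr -lambda0_scalar starser1l. Qed.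

Lemma otimes_bilinear : bilinear_for *:%R *:%R (@otimes R M n).
Proof.
split=> [f k p q|p k f h] /=; apply/ffunP => I; rewrite !ffunE.
  by rewrite scalerDl scalerA.
by rewrite scalerDr !scalerA mulrC.
Qed.
HB.instance Definition _ := bilinear_isBilinear.Build _ _ _ _ _ _ (@otimes R M n)
  otimes_bilinear.

Lemma otimes0l (f : Cinf M) : otimes (0 : G) f = 0.
Proof. exact: linear0l. Qed.
Lemma otimes0r p : otimes p (0 : Cinf M) = 0.
Proof. exact: linear0r. Qed.
Lemma otimesZl (k : R[i]) p (f : Cinf M) : otimes (k *: p) f = k *: otimes p f.
Proof. exact: linearZl_LR. Qed.
Lemma otimesZr (k : R[i]) p (f : Cinf M) : otimes p (k *: f) = k *: otimes p f.
Proof. exact: linearZr_LR. Qed.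
Lemma otimesDl p q (f : Cinf M) : otimes (p + q) f = otimes p f + otimes q f.
Proof. exact: linearDl. Qed.
Lemma otimesBl p q (f : Cinf M) : otimes (p - q) f = otimes p f - otimes q f.
Proof. exact: linearBl. Qed.
Lemma otimesNl p (f : Cinf M) : otimes (- p) f = - otimes p f.
Proof. exact: linearNl. Qed.
Lemma otimesBr p (f h : Cinf M) : otimes p (f - h) = otimes p f - otimes p h.
Proof. exact: linearBr. Qed.
Lemma otimes_suml I (r : seq I) (P : pred I) (E : I -> G) (f : Cinf M) :
  otimes (\sum_(i <- r | P i) E i) f = \sum_(i <- r | P i) otimes (E i) f.
Proof. exact: linear_sumlz. Qed.
Lemma otimes_sumr I (r : seq I) (P : pred I) (E : I -> Cinf M) p :
  otimes p (\sum_(i <- r | P i) E i) = \sum_(i <- r | P i) otimes p (E i).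
Proof. exact: linear_sumr. Qed.

(** The decomposable elements to which star computations are reduced: both gamma and the charges are
    finite sums of them. *)
Definition oser p F : nat -> brst := fun r => otimes p (F r).

Lemma brst_series u : u = \sum_I oser (monomial I) (fun r => u r I).
Proof.
apply/funext => r; rewrite fct_sumE; apply/ffunP => L; rewrite sum_ffunE.
rewrite (bigD1 L) //= big1 ?addr0 => [|I /negPf IL]; rewrite !ffunE.
  by rewrite eqxx scale1r.
by rewrite eq_sym IL scale0r.
Qed.

Lemma starPl kappa (k : R[i]) u v w :
  star C kappa (k *: u + v) w = k *: star C kappa u w + star C kappa v w.
Proof.
apply/funext => r; rewrite -[RHS]/(k *: star C kappa u w r + star C kappa v w r).
rewrite /star scaler_sumr -big_split; apply: eq_bigr => s _ /=.
rewrite scaler_sumr -big_split; apply: eq_bigr => I _ /=.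
rewrite scaler_sumr -big_split; apply: eq_bigr => J _ /=.
have -> : (fun j => (k *: u + v) j I) =
    k *: (fun j => u j I) + (fun j => v j I).
  by apply/funext => j; rewrite !fctE !ffunE.
by rewrite starserPl -linearPr.
Qed.

Lemma starPr kappa (k : R[i]) u v w :
  star C kappa w (k *: u + v) = k *: star C kappa w u + star C kappa w v.
Proof.
apply/funext => r; rewrite -[RHS]/(k *: star C kappa w u r + star C kappa w v r).
rewrite /star scaler_sumr -big_split; apply: eq_bigr => s _ /=.
rewrite scaler_sumr -big_split; apply: eq_bigr => I _ /=.
rewrite scaler_sumr -big_split; apply: eq_bigr => J _ /=.
have -> : (fun j => (k *: u + v) j J) =
    k *: (fun j => u j J) + (fun j => v j J).
  by apply/funext => j; rewrite !fctE !ffunE.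
by rewrite starserPr -linearPr.
Qed.

Lemma starDl kappa u v w :
  star C kappa (u + v) w = star C kappa u w + star C kappa v w.
Proof. by rewrite -{1}[u]scale1r starPl scale1r. Qed.

Lemma starDr kappa u v w :
  star C kappa w (u + v) = star C kappa w u + star C kappa w v.
Proof. by rewrite -{1}[u]scale1r starPr scale1r. Qed.

Lemma star0l kappa u : star C kappa 0 u = 0.
Proof. by have := starPl kappa (-1) 0 0 u; rewrite scaler0 addr0 scaleN1r addNr. Qed.

Lemma star0r kappa u : star C kappa u 0 = 0.
Proof. by have := starPr kappa (-1) 0 0 u; rewrite scaler0 addr0 scaleN1r addNr. Qed.

Lemma star_suml kappa (I : finType) (E : I -> nat -> brst) w :
  star C kappa (\sum_i E i) w = \sum_i star C kappa (E i) w.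
Proof.
by apply: (big_morph (star C kappa ^~ w)) => [u v|]; rewrite ?starDl ?star0l.
Qed.

Lemma star_sumr kappa (I : finType) (E : I -> nat -> brst) w :
  star C kappa w (\sum_i E i) = \sum_i star C kappa w (E i).
Proof.
by apply: (big_morph (star C kappa w)) => [u v|]; rewrite ?starDr ?star0r.
Qed.

(** [star] is defined by expansion over monomials; bilinearity of [circ] recovers the product
    formula for arbitrary Grassmann factors. *)
Lemma star_oser kappa p q F H r :
  star C kappa (oser p F) (oser q H) r =
  \sum_(s < r.+1) otimes (circ kappa p q s) (star_series C F H (r - s)%N).
Proof.
rewrite /star; apply: eq_bigr => s _.
set f := star_series C F H _.
have circ_bilinear : bilinear_for *:%R *:%R (fun p q => otimes (circ kappa p q s) f).
  split=> [x k y z|x k y z] /=; rewrite !circE; set c := _ / _.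
    by rewrite linearPl /= scalerDr otimesDl scalerA [c * k]mulrC -scalerA otimesZl.
  by rewrite linearPr /= scalerDr otimesDl scalerA [c * k]mulrC -scalerA otimesZl.
apply: etrans (esym (bilinear_grassE p q circ_bilinear)).
apply: eq_bigr => I _; apply: eq_bigr => J _.
have -> : (fun j => oser p F j I) = p I *: F + 0.
  by apply/funext => j; rewrite /oser !fctE ffunE addr0.
have -> : (fun j => oser q H j J) = q J *: H + 0.
  by apply/funext => j; rewrite /oser !fctE ffunE addr0.
rewrite starserPl starserPr starser0l starser0r !addr0 fctE.
by rewrite -[X in otimes _ X]/(p I *: (q J *: f)) !otimesZr scalerA.
Qed.

(** Each contraction carries one lambda, so an expression that survives only with a single
    contraction is shifted by one order; this produces [mul_ilambda]. *)
Lemma sum_ord_only1 (W : nmodType) (E : nat -> W) r :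
  (forall s, s != 1%N -> E s = 0) ->
  \sum_(s < r.+1) E s = if r is _.+1 then E 1%N else 0.
Proof.
move=> E0; case: r => [|r]; first by rewrite big_ord1 E0.
rewrite big_ord_recl E0 // add0r big_ord_recl big1 ?addr0 // => s _.
by rewrite E0.
Qed.

(** * The square of Omega plus a quantum momentum map *)

Section Charge.
Context (f : 'I_n -> 'I_n -> 'I_n -> R[i]).
Hypothesis f_skew : forall c a b, f c a b = - f c b a.
Hypothesis f_jacobi : forall l a b d,
  \sum_k (f k a b * f l k d + f k b d * f l k a + f k d a * f l k b) = 0.
Context (F : 'I_n -> series).
Hypothesis F_comm : forall a b,
  star_series C (F a) (F b) - star_series C (F b) (F a) =
  mul_ilambda (\sum_c f c a b *: F c).

Local Notation ee a b := (wedge (generator (up a)) (generator (up b)) : G).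

Lemma charge_star_charge kappa :
  let Q := oser (omega_grass f) one + \sum_a oser (generator (up a)) (F a) in
  star C kappa Q Q = 0.
Proof.
set O := oser _ _; set E := \sum_a _ => Q.
rewrite /Q starDl !starDr -addrA [X in _ + X]addrA.
have -> : star C kappa O O = 0.
  apply/funext => r; rewrite star_oser big1 // => s _.
  by rewrite circE contr_omega // scaler0 otimes0l.
rewrite add0r; apply/funext => r.
have OE : (star C kappa O E + star C kappa E O) r =
    if r is r'.+1 then - (2^-1 * 'i%C) *: \sum_c \sum_a \sum_b
      f c a b *: otimes (ee a b) (F c r') else 0.
  rewrite /E star_suml star_sumr -big_split fct_sumE.
  have -> : \sum_c (star C kappa O (oser (generator (up c)) (F c)) +
        star C kappa (oser (generator (up c)) (F c)) O) r =
      \sum_c if r is r'.+1 then (2 * 'i%C) *: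
        otimes (insl (low c) (omega_grass f)) (F c r') else 0.
    apply: eq_bigr => c _.
    transitivity (\sum_(s < r.+1) otimes (circ kappa (omega_grass f) (generator (up c)) s +
        circ kappa (generator (up c)) (omega_grass f) s) (F c (r - s)%N)).
      rewrite -[LHS]/(star C kappa O (oser (generator (up c)) (F c)) r +
        star C kappa (oser (generator (up c)) (F c)) O r) !star_oser -big_split.
      by apply: eq_bigr => s _; rewrite starser1l starser1r otimesDl.
    rewrite (sum_ord_only1 (E := fun s => otimes (circ kappa (omega_grass f) (generator (up c)) s +
        circ kappa (generator (up c)) (omega_grass f) s) (F c (r - s)%N))) => [|s s1].
      case: r => // r; rewrite !circE -scalerDr contr_omega_up /= expr1 divr1 subSS subn0.
      by rewrite otimesZl.
    by rewrite !circE -scalerDr contr_omega_up (negPf s1) scaler0 otimes0l.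
  case: r => [|r]; first by rewrite big1.
  rewrite scaler_sumr; apply: eq_bigr => c _.
  rewrite insl_low_omega otimesZl scalerA otimes_suml.
  (* Here 2i is the coefficient of a single contraction and -1/4 the normalisation of Omega; the
     result is opposite to the i/2 obtained below from the commutators of the [F a]. *)
  have -> : 2 * 'i%C * - 4^-1 = - (2^-1 * 'i%C) :> R[i] by field.
  congr (_ *: _); apply: eq_bigr => a _; rewrite otimes_suml; apply: eq_bigr => b _.
  by rewrite otimesZl -genE.
have EE : star C kappa E E r = \sum_a \sum_b otimes (ee a b) (star_series C (F a) (F b) r).
  rewrite /E star_suml fct_sumE; apply: eq_bigr => a _.
  rewrite star_sumr fct_sumE; apply: eq_bigr => b _.
  rewrite star_oser big_ord_recl big1 => [|s _].
    by rewrite circE expr0 divr1 scale1r addr0 subn0.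
  by rewrite circE contr_up_up scaler0 otimes0l.
have EE2 : star C kappa E E r =
    if r is r'.+1 then (2^-1 * 'i%C) *: \sum_c \sum_a \sum_b
      f c a b *: otimes (ee a b) (F c r') else 0.
  (* Exchanging [a] and [b] in one copy and anticommuting the generators turns the doubled sum into
     one over commutators; halving it later produces the factor 1/2. *)
  have : star C kappa E E r + star C kappa E E r = \sum_a \sum_b otimes (ee a b)
      ((star_series C (F a) (F b) - star_series C (F b) (F a)) r).
    rewrite EE [X in X + _ = _]exchange_big -big_split; apply: eq_bigr => a _ /=.
    rewrite -big_split; apply: eq_bigr => b _ /=.
    rewrite generatorC otimesNl [LHS]addrC.
    by rewrite -[X in _ = otimes _ X]/(star_series C (F a) (F b) r -
      star_series C (F b) (F a) r) otimesBr.
  have -> : \sum_a \sum_b otimes (ee a b)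
      ((star_series C (F a) (F b) - star_series C (F b) (F a)) r) =
    if r is r'.+1 then 'i%C *: \sum_c \sum_a \sum_b
      f c a b *: otimes (ee a b) (F c r') else 0.
    case: r {OE EE} => [|r].
      by apply: big1 => a _; apply: big1 => b _; rewrite F_comm otimes0r.
    transitivity (\sum_a \sum_b \sum_c 'i%C *: (f c a b *: otimes (ee a b) (F c r))).
      apply: eq_bigr => a _; apply: eq_bigr => b _; rewrite F_comm.
      rewrite -[X in otimes _ X]/('i%C *: (\sum_c f c a b *: F c) r) fct_sumE.
      rewrite otimesZr otimes_sumr scaler_sumr; apply: eq_bigr => c _.
      by rewrite -[X in otimes _ X]/(f c a b *: F c r) otimesZr.
    under eq_bigr do rewrite exchange_big.
    rewrite exchange_big scaler_sumr; apply: eq_bigr => c _ /=.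
    rewrite scaler_sumr; apply: eq_bigr => a _.
    by rewrite scaler_sumr.
  rewrite -mulr2n -scaler_nat => h.
  transitivity ((2^-1 * 2 : R[i]) *: star C kappa E E r).
    by rewrite mulVf ?scale1r ?pnatr_eq0.
  rewrite -scalerA h; case: r {OE EE h} => [|r]; first by rewrite scaler0.
  by rewrite scalerA.
rewrite -[LHS]/((star C kappa O E + star C kappa E O) r + star C kappa E E r).
rewrite OE EE2; case: r {OE EE EE2} => [|r]; first by rewrite addr0.
by rewrite -scalerDl addNr scale0r.
Qed.

End Charge.

End StarProduct.

(** * The ghost number derivation *)

Section GhostDerivation.
Context {R : realType} {M : manifold R} {n : nat}.
Context (C : nat -> Cinf M -> Cinf M -> Cinf M).
Hypothesis C_bilinear : forall r (a : R[i]) (f g h : Cinf M),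
  C r (a *: f + g) h = a *: C r f h + C r g h /\
  C r h (a *: f + g) = a *: C r h f + C r h g.
Hypothesis C_0 : forall f g, C 0%N f g = f * g.
Hypothesis C_unit : forall r f (a : R[i]),
  C r.+1 f (a *: (1 : Cinf M)) = 0 /\ C r.+1 (a *: (1 : Cinf M)) f = 0.

Local Notation K := (R[i]^o).
Local Notation gen := ('I_(n + n)).
Local Notation G := (@grass n K).
Local Notation brst := (@grass n (Cinf M)).
Local Notation series := (nat -> Cinf M).
Local Notation one := (lambda0 (1 : Cinf M)).
Implicit Types (kappa : R) (F H : series) (p q : G) (u v w : nat -> brst).

Lemma grass_even_part p : grade p = p -> forall I : {set gen}, odd #|I| -> p I = 0.
Proof.
move=> /ffunP gp I oI; apply/eq_oppr_eq0; rewrite -[in LHS]gp ffunE.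
by rewrite -signr_odd oI scaleN1r.
Qed.

Lemma gammaE : gamma = oser gamma_grass one :> (nat -> brst).
Proof.
apply/funext => -[|r]; last by rewrite /oser otimes0r.
rewrite /oser /= /gamma_grass otimesZl otimes_suml.
by [].
Qed.

Lemma parity_part_gamma (b : bool) :
  parity_part b (gamma : nat -> brst) = if b then 0 else gamma.
Proof.
have odd0 r (I : {set gen}) : odd #|I| -> (gamma : nat -> brst) r I = 0.
  by move=> oI; rewrite gammaE ffunE (grass_even_part grade_gamma oI) scale0r.
apply/funext => r; apply/ffunP => I; rewrite [LHS]ffunE.
case: b; case: (boolP (odd #|I|)) => oI //=; last by rewrite odd0.
  by rewrite odd0 // ffunE.
by rewrite ffunE.
Qed.

Lemma parity_part_sum u : parity_part true u + parity_part false u = u.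
Proof.
apply/funext => r; apply/ffunP => I; rewrite !fctE !ffunE.
by case: (odd #|I|); rewrite /= ?addr0 ?add0r.
Qed.

(** Since gamma is even, only plus signs occur and the parity parts of [u] recombine. *)
Lemma super_ad_gamma kappa u :
  super_ad C kappa gamma u = star C kappa gamma u - star C kappa u gamma.
Proof.
rewrite /super_ad !big_bool !parity_part_gamma /= expr0 !scale1r !(star0r C_bilinear).
rewrite scaler0 !add0r -(starDl C_bilinear) parity_part_sum.
by [].
Qed.

Section Ghost.
Context (pb : Cinf M -> Cinf M -> Cinf M).
Hypothesis pb_poisson : poisson_bracket pb.

(** The Leibniz rule for 1 = 1 * 1 makes the bracket with 1 equal to twice itself. *)
Lemma pb_unitl (k : R[i]) (f : Cinf M) : pb (k *: (1 : Cinf M)) f = 0.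
Proof.
case: pb_poisson => pbP pbC pbM _ _.
have pb1 : pb f 1 = 0.
  have := pbM f 1 1; rewrite !mulr1 mul1r => /eqP.
  by rewrite -subr_eq0 opprD addrA subrr sub0r oppr_eq0 => /eqP.
have pb0 h : pb 0 h = 0.
  by have := pbP (-1) 0 0 h; rewrite scaler0 addr0 scaleN1r addNr.
by rewrite -[_ *: _]addr0 pbP pb0 addr0 pbC pb1 oppr0 scaler0.
Qed.

Lemma pb_0l (f : Cinf M) : pb 0 f = 0.
Proof. by have := pb_unitl 0 f; rewrite scale0r. Qed.

(** The coefficients of gamma are constant functions, so the Poisson part of the super bracket
    vanishes and only [gamma_bracket] remains. The diagonal form reduces the grading statements to
    comparing integers. *)
Lemma GhE u r I : Gh pb u r I = (ghost I)%:~R *: u r I.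
Proof.
rewrite /Gh /super_bracket big_ord_recl [X in _ + X]big1 ?addr0 => [|s _]; last first.
  apply: big1 => J _; apply: big1 => L _.
  by rewrite gammaE /oser /= otimes0r ffunE pb_0l mul0r !otimes0r addr0.
rewrite subn0.
have -> : \sum_(J : {set gen}) \sum_(L : {set gen})
    (otimes (wedge (monomial J) (monomial L)) (pb (gamma 0%N J) (u r L)) +
     otimes (grass_bracket (monomial J) (monomial L)) (gamma 0%N J * u r L)) =
    \sum_L otimes (grass_bracket gamma_grass (monomial L)) (u r L) :> brst.
  rewrite exchange_big; apply: eq_bigr => L _.
  have -> : grass_bracket gamma_grass (monomial L) =
      \sum_J gamma_grass J *: grass_bracket (monomial J) (monomial L) :> G.
    under [RHS]eq_bigr do rewrite grass_bracketE scalerA mulrC -scalerA.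
    rewrite -scaler_sumr grass_bracketE; congr (_ *: _).
    under [RHS]eq_bigr do rewrite scaler_sumr.
    rewrite exchange_big; apply: eq_bigr => v _.
    rewrite {1}[gamma_grass]grassE linear_sum wedge_suml; apply: eq_bigr => J _ /=.
    by rewrite linearZ wedgeZl.
  rewrite otimes_suml; apply: eq_bigr => J _.
  rewrite gammaE /oser ffunE pb_unitl otimes0r add0r -Cinf_scalerAl mul1r.
  by rewrite [LHS]otimesZr [RHS]otimesZl.
rewrite sum_ffunE (bigD1 I) //= big1 ?addr0 => [|L /negPf LI].
  by rewrite ffunE gamma_bracket !ffunE eqxx mulr1.
by rewrite ffunE gamma_bracket !ffunE eq_sym LI mulr0 scale0r.
Qed.

Lemma Gh_homog u (m : int) : Gh pb u = u *~ m <-> ghost_homog m u.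
Proof.
have -> : u *~ m = m%:~R *: u by rewrite scaler_int.
split=> [h r I Im|h].
  have : Gh pb u r I = (m%:~R *: u) r I by rewrite h.
  rewrite GhE -[(m%:~R *: u) r I]/([ffun J => m%:~R *: u r J] I) ffunE => /eqP.
  rewrite -subr_eq0 -scalerBl scaler_eq0 -rmorphB intr_eq0 subr_eq0 (negPf Im).
  by move/eqP.
apply/funext => r; apply/ffunP => I; rewrite GhE.
rewrite -[(m%:~R *: u) r I]/([ffun J => m%:~R *: u r J] I) ffunE.
by case: (eqVneq (ghost I) m) => [->//|/h ->]; rewrite !scaler0.
Qed.

(** The 2i of a single contraction times the 1/2 of [contr_gamma_comm1] is exactly the i of
    [mul_ilambda]. *)
Lemma circ_gamma_comm kappa p s :
  circ kappa gamma_grass p s - circ kappa p gamma_grass s =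
  if s == 1%N then 'i%C *: [ffun L : {set gen} => (ghost L)%:~R * p L] else 0.
Proof.
rewrite !circE -scalerBr; case: s => [|[|[|s]]].
- by rewrite contr_gamma_comm0 subrr scaler0.
- rewrite contr_gamma_comm1 scalerA expr1 divr1; congr (_ *: _).
  by field.
- by rewrite contr_gamma_comm2 subrr scaler0.
- by rewrite contr_gamma_comm3 subrr scaler0.
Qed.

Lemma ad_gamma kappa u : mul_ilambda (Gh pb u) = super_ad C kappa gamma u.
Proof.
rewrite super_ad_gamma; apply/funext => r.
rewrite -[RHS]/(star C kappa gamma u r - star C kappa u gamma r).
have -> : star C kappa gamma u r = \sum_J \sum_(s < r.+1)
    otimes (circ kappa gamma_grass (monomial J) s) (u (r - s)%N J).
  rewrite {1}[u]brst_series (star_sumr C_bilinear) fct_sumE; apply: eq_bigr => J _.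
  by rewrite gammaE (star_oser C_bilinear); apply: eq_bigr => s _; rewrite (starser1l C_0 C_unit).
have -> : star C kappa u gamma r = \sum_J \sum_(s < r.+1)
    otimes (circ kappa (monomial J) gamma_grass s) (u (r - s)%N J).
  rewrite {1}[u]brst_series (star_suml C_bilinear) fct_sumE; apply: eq_bigr => J _.
  by rewrite gammaE (star_oser C_bilinear); apply: eq_bigr => s _; rewrite (starser1r C_0 C_unit).
rewrite -sumrB.
(* Common form of both sides: nothing at order 0, and at order r' + 1 the ghost-weighted coefficient
   r' of [u], expanded over monomials. *)
transitivity (\sum_(J : {set gen}) if r is r'.+1 then
    otimes ('i%C *: [ffun L : {set gen} => (ghost L)%:~R * monomial J L]) (u r' J)
    else 0 : brst).
  case: r => [|r]; first by rewrite big1.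
  apply/ffunP => L; rewrite [LHS]ffunE GhE sum_ffunE (bigD1 L) //= big1 ?addr0.
    by rewrite !ffunE eqxx mulr1 scalerA.
  by move=> J /negPf JL; rewrite !ffunE eq_sym JL mulr0 scaler0 scale0r.
apply: eq_bigr => J _; rewrite -sumrB.
transitivity (\sum_(s < r.+1) otimes (if s == 1%N :> nat then
    'i%C *: [ffun L : {set gen} => (ghost L)%:~R * (monomial J : G) L] else 0)
    (u (r - s)%N J)); last first.
  by apply: eq_bigr => s _; rewrite -(circ_gamma_comm kappa) otimesBl.
rewrite (sum_ord_only1 (E := fun s => otimes (if s == 1%N then
    'i%C *: [ffun L : {set gen} => (ghost L)%:~R * (monomial J : G) L] else 0)
    (u (r - s)%N J))) => [|s /negPf ->]; last exact: otimes0l.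
by case: r => // r; rewrite subSS subn0.
Qed.

End Ghost.

End GhostDerivation.

(** * Ghost number *)

Section GhostDegree.
Context {R : realType} {n : nat}.
Local Notation K := (R[i]^o).
Local Notation gen := ('I_(n + n)).
Local Notation G := (@grass n K).
Implicit Types (kappa : R) (p q : G) (v w : gen) (I J L : {set gen}) (i j m : int).

Definition ghost_pure m p := forall L, ghost L != m -> p L = 0.

(** Complementary to [ghost_homog]: a single component is absent. This allows an arbitrary series to
    be examined at one ghost number without decomposing it into homogeneous parts. *)
Definition ghost_free (V : zmodType) m (u : nat -> @grass n V) :=
  forall r L, ghost L = m -> u r L = 0.

Lemma ghostU1 v L : v \notin L -> ghost (v |: L) = gsign v + ghost L.
Proof. by move=> vL; rewrite !ghostE big_setU1. Qed.

Lemma ghostID I L : I \subset L -> ghost L = ghost I + ghost (L :\: I).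
Proof. by move=> IL; rewrite !ghostE (big_setID I) /= (finset.setIidPr IL). Qed.

Lemma ghost_pure_monomial I : ghost_pure (ghost I) (monomial I).
Proof. by move=> L; rewrite ffunE; case: (L =P I) => [->|//]; rewrite eqxx. Qed.

Lemma ghost_pure_wedge i j p q :
  ghost_pure i p -> ghost_pure j q -> ghost_pure (i + j) (wedge p q).
Proof.
move=> pi qj L Lij; rewrite ffunE big1 // => I IL.
have [Ii|/pi ->] := eqVneq (ghost I) i; last by rewrite mulr0 mul0r.
rewrite qj ?mulr0 //; apply: contraNneq Lij => Jj.
by rewrite (ghostID IL) Ii Jj.
Qed.

Lemma ghost_pure_insl i v p : ghost_pure i p -> ghost_pure (i - gsign v) (insl v p).
Proof.
move=> pi L Li; rewrite ffunE; case: ifP => // /negbT vL.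
rewrite pi ?scaler0 //; apply: contraNneq Li => <-.
by rewrite (ghostU1 vL) addrAC subrr add0r.
Qed.

Lemma ghost_pure_insr i v p : ghost_pure i p -> ghost_pure (i - gsign v) (insr v p).
Proof.
move=> pi; apply: ghost_pure_insl => L Li.
by rewrite ffunE pi // scaler0 oppr0.
Qed.

(** A contraction removes [v] on the left and its dual on the right, whose ghost numbers cancel. *)
Lemma ghost_pure_contr kappa s i j p q :
  ghost_pure i p -> ghost_pure j q -> ghost_pure (i + j) (contr kappa s p q).
Proof.
elim: s i j p q => [|s IH] i j p q pi qj; first exact: ghost_pure_wedge.
move=> L Lij; rewrite contrS sum_ffunE big1 // => v _.
rewrite ffunE (IH (i - gsign v) (j - gsign (dual v))) ?scaler0 //.
- exact: ghost_pure_insr.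
- exact: ghost_pure_insl.
by rewrite gsign_dual opprK addrACA addNr addr0.
Qed.

Lemma ghost_pure_circ kappa s i j p q :
  ghost_pure i p -> ghost_pure j q -> ghost_pure (i + j) (circ kappa p q s).
Proof.
move=> pi qj L Lij; rewrite circE ffunE (ghost_pure_contr kappa s pi qj Lij).
exact: scaler0.
Qed.

(** [Delta] removes one e^k and one e_k together, so it preserves ghost number; hence so does
    [Sop]. *)
Lemma ghost_free_iter_Delta (V : lmodType R[i]) m s (a : @grass n V) :
  (forall L, ghost L = m -> a L = 0) ->
  forall L, ghost L = m -> iter s Delta a L = 0.
Proof.
move=> a0; elim: s => [|s IH] //= L Lm; rewrite sum_ffunE big1 // => k _.
rewrite ffunE; case: ifP => // /negbT uL; rewrite ffunE; case: ifP => [|/negbT lL].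
  by rewrite scaler0.
rewrite IH ?scaler0 //.
by rewrite (ghostU1 lL) (ghostU1 uL) gsign_up gsign_low addrA addNr add0r.
Qed.

Section Series.
Context {V : lmodType R[i]}.
Implicit Types u : nat -> @grass n V.

Lemma seriesPE (k : R[i]) u u' r L : (k *: u + u') r L = k *: u r L + u' r L.
Proof. by rewrite -[LHS]/((k *: u r + u' r) L) !ffunE. Qed.

Lemma seriesBE u u' r L : (u - u') r L = u r L - u' r L.
Proof. by rewrite -[LHS]/((u r - u' r) L) !ffunE. Qed.

Lemma ghost_free0 m : ghost_free m (0 : nat -> @grass n V).
Proof. by move=> r L _; rewrite ffunE. Qed.

Lemma ghost_freeP m (k : R[i]) u u' :
  ghost_free m u -> ghost_free m u' -> ghost_free m (k *: u + u').
Proof.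
move=> hu hu' r L Lm; rewrite seriesPE hu ?hu' //.
by rewrite scaler0 addr0.
Qed.

Lemma ghost_free_Sop m (t : R) u : ghost_free m u -> ghost_free m (Sop t u).
Proof.
move=> hu r L Lm; rewrite /Sop sum_ffunE big1 // => s _; rewrite ffunE.
by rewrite (@ghost_free_iter_Delta _ m) ?scaler0 // => I; exact: hu.
Qed.

Lemma ghost_free_parity m (b : bool) u : ghost_free m u -> ghost_free m (parity_part b u).
Proof. by move=> hu r L Lm; rewrite ffunE hu // if_same. Qed.

Lemma ghost_homog_parity m (b : bool) u : ghost_homog m u -> ghost_homog m (parity_part b u).
Proof. by move=> hu r L Lm; rewrite ffunE hu // if_same. Qed.

Lemma parity_partP (b : bool) (k : R[i]) u u' :
  parity_part b (k *: u + u') = k *: parity_part b u + parity_part b u'.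
Proof.
apply/funext => r; apply/ffunP => L; rewrite ffunE.
rewrite !seriesPE !ffunE.
by case: ifP; rewrite // scaler0 addr0.
Qed.

Lemma SopP (t : R) (k : R[i]) u u' : Sop t (k *: u + u') = k *: Sop t u + Sop t u'.
Proof.
apply/funext => r; rewrite -[RHS]/(k *: Sop t u r + Sop t u' r) /Sop.
rewrite scaler_sumr -big_split; apply: eq_bigr => s _ /=.
rewrite -[(k *: u + u') _]/(k *: u (r - s)%N + u' (r - s)%N) iter_Delta_linear.
by rewrite scalerDr !scalerA mulrC.
Qed.

End Series.
End GhostDegree.

Section GhostGrading.
Context {R : realType} {M : manifold R} {n : nat}.
Context (C : nat -> Cinf M -> Cinf M -> Cinf M).
Hypothesis C_bilinear : forall r (a : R[i]) (f g h : Cinf M),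
  C r (a *: f + g) h = a *: C r f h + C r g h /\
  C r h (a *: f + g) = a *: C r h f + C r h g.
Hypothesis C_0 : forall f g, C 0%N f g = f * g.
Hypothesis C_unit : forall r f (a : R[i]),
  C r.+1 f (a *: (1 : Cinf M)) = 0 /\ C r.+1 (a *: (1 : Cinf M)) f = 0.

Local Notation K := (R[i]^o).
Local Notation gen := ('I_(n + n)).
Local Notation G := (@grass n K).
Local Notation brst := (@grass n (Cinf M)).
Local Notation series := (nat -> Cinf M).
Local Notation one := (lambda0 (1 : Cinf M)).
Implicit Types (kappa : R) (F H : series) (p q : G) (u v w : nat -> brst).

(** If the left monomial has ghost number [i], component [i + m] can only arise from component [m]
    of [v], which is absent. *)
Lemma ghost_free_starl kappa i m u v :
  ghost_homog i u -> ghost_free m v -> ghost_free (i + m) (star C kappa u v).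
Proof.
move=> ui vm r L Lim; rewrite /star sum_ffunE big1 // => s _.
rewrite sum_ffunE big1 // => I _; rewrite sum_ffunE big1 // => J _; rewrite ffunE.
have [Ii|Ii] := eqVneq (ghost I) i; last first.
  have -> : (fun k => u k I) = 0 by apply/funext => k; exact: ui.
  by rewrite (starser0l C_bilinear) scaler0.
have [Jm|Jm] := eqVneq (ghost J) m.
  have -> : (fun k => v k J) = 0 by apply/funext => k; exact: vm.
  by rewrite (starser0r C_bilinear) scaler0.
rewrite (ghost_pure_circ kappa s (@ghost_pure_monomial _ _ I) (@ghost_pure_monomial _ _ J)).
  exact: scale0r.
by rewrite Lim Ii (inj_eq (addrI i)) eq_sym.
Qed.

Lemma ghost_free_starr kappa i m u v :
  ghost_homog i u -> ghost_free m v -> ghost_free (i + m) (star C kappa v u).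
Proof.
move=> ui vm r L Lim; rewrite /star sum_ffunE big1 // => s _.
rewrite sum_ffunE big1 // => J _; rewrite sum_ffunE big1 // => I _; rewrite ffunE.
have [Ii|Ii] := eqVneq (ghost I) i; last first.
  have -> : (fun k => u k I) = 0 by apply/funext => k; exact: ui.
  by rewrite (starser0r C_bilinear) scaler0.
have [Jm|Jm] := eqVneq (ghost J) m.
  have -> : (fun k => v k J) = 0 by apply/funext => k; exact: vm.
  by rewrite (starser0l C_bilinear) scaler0.
rewrite (ghost_pure_circ kappa s (@ghost_pure_monomial _ _ J) (@ghost_pure_monomial _ _ I)).
  exact: scale0r.
by rewrite Lim Ii addrC (inj_eq (addIr i)) eq_sym.
Qed.

Lemma super_adE kappa u v : super_ad C kappa u v = star C kappa u v -
  (- star C kappa (parity_part true v) (parity_part true u) +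
   star C kappa (parity_part false v) (parity_part true u) +
  (star C kappa (parity_part true v) (parity_part false u) +
   star C kappa (parity_part false v) (parity_part false u))).
Proof. by rewrite /super_ad !big_bool /= expr1 expr0 !scale1r scaleN1r. Qed.

Lemma ghost_free_super_ad kappa i m u v :
  ghost_homog i u -> ghost_free m v -> ghost_free (i + m) (super_ad C kappa u v).
Proof.
move=> ui vm; rewrite super_adE.
have st b b' : ghost_free (i + m) (star C kappa (parity_part b v) (parity_part b' u)).
  by apply: ghost_free_starr; [exact: ghost_homog_parity|exact: ghost_free_parity].
have fD x y : ghost_free (i + m) x -> ghost_free (i + m) y ->
    ghost_free (i + m) (x + y :> (nat -> brst)).
  by move=> hx hy; rewrite -[x]scale1r; exact: ghost_freeP.
have fN x : ghost_free (i + m) x -> ghost_free (i + m) (- x :> (nat -> brst)).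
  move=> hx; rewrite -[- x]addr0 -scaleN1r; apply: ghost_freeP => //.
  exact: ghost_free0.
apply: (fD); first exact: ghost_free_starl.
by apply: (fN); apply: (fD); [apply: (fD); [apply: (fN)|]|apply: (fD)]; exact: st.
Qed.

Lemma super_adP kappa (k : R[i]) u v w :
  super_ad C kappa w (k *: u + v) = k *: super_ad C kappa w u + super_ad C kappa w v.
Proof.
have lcD (x x' y y' : nat -> brst) :
    (k *: x + x') + (k *: y + y') = k *: (x + y) + (x' + y').
  by rewrite addrACA scalerDr.
have lcN (x x' : nat -> brst) : - (k *: x + x') = k *: - x + - x'.
  by rewrite opprD scalerN.
rewrite !super_adE !parity_partP !(starPl C_bilinear) (starPr C_bilinear).
by rewrite lcN !lcD lcN lcD.
Qed.

(** * The BRST differential and ghost number *)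

Section Differential.
Context {g : vectType R} (br : g -> g -> g) (e : n.-tuple g)
        (J : nat -> smooth_dual M g) (kappa : R).
Local Notation D := (D_kappa C br e J kappa).

Lemma D_kappaP (k : R[i]) u v : D (k *: u + v) = k *: D u + D v.
Proof.
rewrite /D_kappa -SopP SopP; congr Sop; rewrite /D_W super_adP.
apply/funext => r.
set a := super_ad _ _ _ _; set b := super_ad _ _ _ _.
rewrite -[RHS]/(k *: (- 'i%C *: a r.+1) + - 'i%C *: b r.+1) scalerA [k * _]mulrC.
by rewrite -scalerA -scalerDr.
Qed.

Hypothesis Theta_W_homog : ghost_homog 1 (Theta_W br e J).

Lemma ghost_free_D m u : ghost_free m u -> ghost_free (m + 1) (D u).
Proof.
move=> um; apply: ghost_free_Sop => r L Lm; rewrite /D_W /div_ilambda ffunE.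
rewrite (@ghost_free_super_ad _ 1 m) ?scaler0 //; last by rewrite Lm addrC.
exact: ghost_free_Sop.
Qed.

Lemma ghost_homog_D m u : ghost_homog m u -> ghost_homog (m + 1) (D u).
Proof.
(* The coefficient at [L] depends only on the component of [u] of ghost number [ghost L - 1], which
   differs from [m] and hence vanishes. *)
move=> um r L Lm; apply: (@ghost_free_D (ghost L - 1)); last by rewrite subrK.
move=> s I Im; apply: um; rewrite Im; apply: contraNneq Lm => <-.
by rewrite subrK.
Qed.

(** Fix [L] and put c = ghost L - 1. The element Gh u - c u has no component of ghost number c, so
    its image under [D] vanishes at [L]. There [D] after [Gh] is thus c times [D u], whereas [Gh]
    after [D] is c + 1 times it. *)
Lemma Gh_D (pb : Cinf M -> Cinf M -> Cinf M) u : poisson_bracket pb ->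
  Gh pb (D u) - D (Gh pb u) = D u.
Proof.
move=> pbP; apply/funext => r; apply/ffunP => L.
pose c : R[i] := (ghost L - 1)%:~R.
have h : D (Gh pb u) r L = c *: D u r L.
  have free : ghost_free (ghost L - 1) (- c *: u + Gh pb u).
    move=> s I Im; rewrite seriesPE GhE //.
    by rewrite Im scaleNr addNr.
  have := @ghost_free_D _ _ free r L; rewrite subrK D_kappaP => /(_ erefl).
  rewrite seriesPE scaleNr addrC.
  by move/eqP; rewrite subr_eq0 => /eqP.
rewrite seriesBE GhE // [X in _ - X]h -scalerBl.
by rewrite /c -intrB subKr scale1r.
Qed.

End Differential.

End GhostGrading.

(** * The charges *)

Section Delta.
Context {R : realType} {M : manifold R} {n : nat}.
Local Notation K := (R[i]^o).
Local Notation gen := ('I_(n + n)).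
Local Notation G := (@grass n K).
Local Notation brst := (@grass n (Cinf M)).

Lemma insl_otimes v (p : G) (f : Cinf M) : insl v (otimes p f) = otimes (insl v p) f.
Proof.
apply/ffunP => L; rewrite !ffunE; case: ifP => _; first by rewrite scale0r.
by rewrite scalerA.
Qed.

Lemma Delta_otimes (p : G) (f : Cinf M) : Delta (otimes p f) = otimes (Delta p) f.
Proof.
rewrite /Delta otimes_suml; apply: eq_bigr => k _.
by rewrite /ivec /icov !insl_otimes.
Qed.

Lemma ghost_pure_generator (v : gen) : ghost_pure (gsign v) (generator v : G).
Proof.
have <- : ghost [set v] = gsign v by rewrite ghostE big_set1.
exact: ghost_pure_monomial.
Qed.

Lemma pairing_linear {g : vectType R} (j : smooth_dual M g) (k : R) (x y : g) :
  pairing j (k *: x + y) = k%:C%C *: pairing j x + pairing j y.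
Proof.
apply: val_inj; apply/funext => m /=; rewrite linearP /=.
by rewrite rmorphD rmorphM.
Qed.

Lemma pairing_sum {g : vectType R} (j : smooth_dual M g) (s : 'I_n -> R) (x : 'I_n -> g) :
  pairing j (\sum_c s c *: x c) = \sum_c (s c)%:C%C *: pairing j (x c).
Proof.
have pairing0 : pairing j 0 = 0.
  by have := pairing_linear j (-1) 0 0; rewrite scaler0 addr0 rmorphN1 scaleN1r addNr.
elim/big_rec2: _ => // c u v _ <-; exact: pairing_linear.
Qed.

End Delta.

Section Charges.
Context {R : realType} {M : manifold R} {n : nat}.
Context {g : vectType R} (br : g -> g -> g) (e : n.-tuple g)
        (J : nat -> smooth_dual M g).
Hypothesis lie_br : lie_bracket br.
Hypothesis basis_e : basis_of fullv e.
Local Notation K := (R[i]^o).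
Local Notation gen := ('I_(n + n)).
Local Notation G := (@grass n K).
Local Notation brst := (@grass n (Cinf M)).
Local Notation one := (lambda0 (1 : Cinf M)).
Local Notation f := (fun c a b : 'I_n => (structure_const br e c a b)%:C%C : R[i]).

Lemma structure_constC_skew c a b : f c a b = - f c b a.
Proof. by rewrite -rmorphN /= -sc_skew. Qed.

Lemma structure_constC_jacobi l a b d :
  \sum_k (f k a b * f l k d + f k b d * f l k a + f k d a * f l k b) = 0.
Proof.
rewrite -[RHS](rmorph0 (real_complex R)) -(sc_jacobi lie_br basis_e l a b d) rmorph_sum.
by apply: eq_bigr => k _; rewrite !rmorphD !rmorphM.
Qed.

Lemma OmegaE : Omega br e = oser (omega_grass f) one.
Proof.
apply/funext => -[|r]; last by rewrite /oser otimes0r.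
rewrite /oser /= /omega_grass otimesZl otimes_suml; congr (_ *: _).
apply: eq_bigr => a _; rewrite otimes_suml; apply: eq_bigr => b _.
rewrite otimes_suml; apply: eq_bigr => c _.
by rewrite wedge_unitr wedgeA.
Qed.

Lemma JchargeE :
  Jcharge e J = \sum_a oser (generator (up a)) (fun r => pairing (J r) e`_a).
Proof. by apply/funext => r; rewrite fct_sumE. Qed.

Lemma Theta_W_homog : ghost_homog 1 (Theta_W br e J).
Proof.
move=> r L L1; rewrite /Theta_W OmegaE.
have gen_up (a : 'I_n) : ghost_pure 1 (generator (up a) : G).
  by rewrite -(gsign_up a); exact: ghost_pure_generator.
have gen_low (a : 'I_n) : ghost_pure (-1) (generator (low a) : G).
  by rewrite -(gsign_low a); exact: ghost_pure_generator.
have omega_pure : ghost_pure 1 (omega_grass f).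
  move=> I I1; rewrite ffunE sum_ffunE big1 ?scaler0 // => a _.
  rewrite sum_ffunE big1 // => b _; rewrite sum_ffunE big1 // => c _.
  rewrite ffunE wedge_unitr.
  rewrite (ghost_pure_wedge (gen_up a) (ghost_pure_wedge (gen_up b) (gen_low c))) //.
  exact: scaler0.
rewrite -[LHS]/((oser (omega_grass f) one r + Jcharge e J r) L) ffunE.
rewrite /oser ffunE omega_pure // scale0r add0r /Jcharge sum_ffunE big1 // => a _.
by rewrite ffunE gen_up // scale0r.
Qed.

Lemma chi_coef a : (2^-1 * \sum_b f b a b : R[i]) = (trace_form br e e`_a)%:C%C.
Proof. by rewrite trace_form_sc rmorphM rmorph_sum fmorphV rmorphMn rmorph1. Qed.

Lemma Delta_Theta_W r : Delta (Theta_W br e J r) = chi br e r :> brst.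
Proof.
rewrite -[Theta_W br e J r]/(Omega br e r + Jcharge e J r) linearD /=.
have -> : Delta (Jcharge e J r) = 0.
  rewrite linear_sum big1 // => a _ /=.
  by rewrite Delta_otimes Delta_generator otimes0l.
rewrite addr0 OmegaE /oser Delta_otimes Delta_omega; last exact: structure_constC_skew.
case: r => [|r]; last by rewrite otimes0r.
by rewrite /chi /= otimes_suml; apply: eq_bigr => a _; rewrite chi_coef.
Qed.

Lemma Delta_chi r : Delta (chi br e r) = 0 :> brst.
Proof.
case: r => [|r]; last exact: linear0.
rewrite /chi /= linear_sum big1 // => a _.
by rewrite /= Delta_otimes linearZ /= Delta_generator scaler0 otimes0l.
Qed.

(** [Delta] maps the Weyl charge to chi and chi to 0, so the exponential stops after its linear
    term, whose coefficient is 2i times 1/2 - kappa. *)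
Lemma Theta_kappaE kappa : Theta_kappa br e J kappa = Omega br e + Jcharge e J +
  mul_ilambda ((1 - 2 * kappa)%:C%C *: chi br e).
Proof.
apply/funext => r; rewrite /Theta_kappa /Sop.
rewrite -[RHS]/(Theta_W br e J r + mul_ilambda ((1 - 2 * kappa)%:C%C *: chi br e) r).
rewrite big_ord_recl /= expr0 divr1 scale1r subn0; congr (_ + _).
case: r => [|r]; first by rewrite big_ord0.
rewrite big_ord_recl /= [X in _ + X]big1 ?addr0 => [|s _]; last first.
  by rewrite -!iterS !iterSr Delta_Theta_W Delta_chi linear0 scaler0.
rewrite Delta_Theta_W subSS subn0 expr1 divr1.
rewrite -[RHS]/('i%C *: ((1 - 2 * kappa)%:C%C *: chi br e r)) scalerA.
congr (_ *: _); rewrite mulrAC mulrC -[2]/(2%:R) -(rmorph_nat (real_complex R)) -rmorphM.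
congr (_ * (_)%:C%C); by field.
Qed.

Context (C : nat -> Cinf M -> Cinf M -> Cinf M).
Hypothesis C_bilinear : forall r (a : R[i]) (f g h : Cinf M),
  C r (a *: f + g) h = a *: C r f h + C r g h /\
  C r h (a *: f + g) = a *: C r h f + C r h g.
Hypothesis C_0 : forall f g, C 0%N f g = f * g.
Hypothesis C_unit : forall r f (a : R[i]),
  C r.+1 f (a *: (1 : Cinf M)) = 0 /\ C r.+1 (a *: (1 : Cinf M)) f = 0.
Hypothesis J_quantum : forall xi eta,
  star_series C (pairing^~ xi \o J) (pairing^~ eta \o J) -
  star_series C (pairing^~ eta \o J) (pairing^~ xi \o J) =
  mul_ilambda (pairing^~ (br xi eta) \o J).

Lemma Theta_kappa_nilpotent kappa :
  star C kappa (Theta_kappa br e J kappa) (Theta_kappa br e J kappa) = 0.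
Proof.
(* The correction is absorbed into the momentum map as a constant series [S a] concentrated at order
   one in lambda. *)
pose c a r : R[i] := if r == 1%N then 'i%C * ((1 - 2 * kappa)%:C%C *
  (trace_form br e e`_a)%:C%C) else 0.
pose S a : nat -> Cinf M := fun r => c a r *: (1 : Cinf M).
pose F (a : 'I_n) : nat -> Cinf M := (pairing^~ e`_a \o J) + S a.
have -> : Theta_kappa br e J kappa =
    oser (omega_grass f) one + \sum_a oser (generator (up a)) (F a).
  rewrite Theta_kappaE OmegaE JchargeE -addrA; congr (_ + _).
  have -> : mul_ilambda ((1 - 2 * kappa)%:C%C *: chi br e) =
      \sum_a oser (generator (up a)) (S a) :> (nat -> brst).
    apply/funext => r; rewrite fct_sumE /oser /S /c.
    case: r => [|[|r]]; rewrite /=.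
    - by rewrite big1 // => a _; rewrite scale0r otimes0r.
    - rewrite -[_ *: chi br e]/(fun r => (1 - 2 * kappa)%:C%C *: chi br e r) /=.
      rewrite !scaler_sumr; apply: eq_bigr => a _.
      by rewrite otimesZl otimesZr !scalerA mulrA.
    - rewrite big1; last by move=> a _; rewrite scale0r otimes0r.
      by rewrite -[_ *: chi br e]/(fun r => (1 - 2 * kappa)%:C%C *: chi br e r) /= !scaler0.
  rewrite -big_split; apply: eq_bigr => a _; apply/funext => r.
  by rewrite /oser /F /= [RHS]linearDr.
apply: (charge_star_charge C_bilinear C_0 C_unit structure_constC_skew structure_constC_jacobi) => a b.
have SC a' H : star_series C H (S a') = star_series C (S a') H.
  exact: (starser_scalarr C_0 C_unit).
have -> : star_series C (F a) (F b) - star_series C (F b) (F a) =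
    mul_ilambda (pairing^~ (br e`_a e`_b) \o J).
  (* All products containing some [S] are central and cancel between the two orders; only the
     commutator of the original momentum components is left. *)
  rewrite /F !(starserDl C_bilinear) !(starserDr C_bilinear).
  rewrite (SC b) (SC a (pairing^~ _ \o J)) (SC b (S a)).
  rewrite [X in _ - X]addrACA opprD addrACA subrr addr0.
  by rewrite opprD addrACA subrr addr0 J_quantum.
(* It remains to see that the shifts do not alter the right-hand side: their combination with the
   structure constants is a multiple of chi on a bracket, hence zero. *)
congr mul_ilambda; apply/funext => r; rewrite fct_sumE.
transitivity (\sum_k (f k a b *: pairing (J r) e`_k + f k a b *: S k r)); last first.
  by apply: eq_bigr => k _; rewrite -scalerDr.
rewrite big_split /= (br_basis br basis_e) pairing_sum [X in _ + X](_ : _ = 0) ?addr0 //.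
rewrite /S /c; case: eqP => _; last by rewrite big1 // => k _; rewrite scale0r scaler0.
under eq_bigr do rewrite scalerA mulrCA [f _ _ _ * _]mulrCA -rmorphM /=.
by rewrite -scaler_suml -!mulr_sumr -rmorph_sum (sum_sc_trace lie_br basis_e) !mulr0 scale0r.
Qed.

End Charges.

Theorem lemma12 (R : realType) (M : manifold R)
  (pb : Cinf M -> Cinf M -> Cinf M)
  (C : nat -> Cinf M -> Cinf M -> Cinf M)
  (g : vectType R) (br : g -> g -> g) (n : nat) (e : n.-tuple g)
  (J : nat -> smooth_dual M g) (kappa : R) :
  poisson_bracket pb ->
  star_product pb C ->
  lie_bracket br ->
  basis_of fullv e ->
  quantum_momentum_map pb C br J ->
  0 <= kappa <= 1 ->
  [/\ Theta_kappa br e J kappa =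
        Omega br e + Jcharge e J +
        mul_ilambda ((1 - 2 * kappa)%:C%C *: chi br e),
      star C kappa (Theta_kappa br e J kappa) (Theta_kappa br e J kappa) = 0,
      (forall u : nat -> @grass n (Cinf M),
         mul_ilambda (Gh pb u) = super_ad C kappa gamma u) /\
      (forall (u : nat -> @grass n (Cinf M)) (m : int),
         Gh pb u = u *~ m <-> ghost_homog m u) &
      (forall u : nat -> @grass n (Cinf M),
         Gh pb (D_kappa C br e J kappa u) - D_kappa C br e J kappa (Gh pb u) =
         D_kappa C br e J kappa u) /\
      (forall (u : nat -> @grass n (Cinf M)) (m : int),
         ghost_homog m u -> ghost_homog (m + 1) (D_kappa C br e J kappa u))].
Proof.
move=> pbP [[_ Clin] _ C0 _ C1] lieb basise [_ JQ] _; split.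
- exact: Theta_kappaE.
- exact: (Theta_kappa_nilpotent lieb basise Clin C0 C1 JQ).
- by split=> [u|u m]; [exact: ad_gamma|exact: Gh_homog].
- have homog := Theta_W_homog br e J.
  by split=> [u|u m]; [exact: Gh_D|exact: ghost_homog_D].
Qed.
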